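(* Let $n\ge1$ and $\mathbb{A}\in\{\mathbb{Z},\mathbb{Q},\mathbb{R}\}$. Every single point set $\{l\}\subset\mathcal{A}_{A_n}(\mathbb{A}^t)$ is a convex set. Given finitely many points $l_1,\dots,l_m\in\mathcal{A}_{A_n}(\mathbb{A}^t)$, their Minkowski sum $$\sum_{k=1}^m l_k:=\Big\{x\in\mathcal{A}_{A_n}(\mathbb{A}^t) : F^t(x)\le\sum_{k=1}^m F^t(l_k)\ \text{ for all } F\in\mathbf{E}(\mathcal{A}_{A_n})\Big\}$$ is a Stasheff polytope $\mathcal{F}_c^\emptyset$ (in $\mathcal{A}_{A_n}(\mathbb{A}^t)$) with $$c_{ij}=\sum_{k=1}^m A_{ij}^t(l_k)\quad\text{for every diagonal }\{ij\}.$$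
   Context: Polygon. Fix an $(n+3)$-gon with vertices labeled $1,\dots,n+3$ clockwise. A segment $\{ij\}$ joins two distinct vertices; it is an edge if they are adjacent and a diagonal otherwise. A partial triangulation is a (possibly empty) set of pairwise non-crossing diagonals; it is complete if maximal. ''$i,j,k,l$ seated clockwise'' means four distinct vertices occurring in this cyclic clockwise order. (Diagonals correspond bijectively to the almost positive roots $\Phi_{\ge-1}$ of type $A_n$, compatibility being non-crossing; $A_\alpha$ is the variable $A_{ij}$ of the corresponding diagonal.) The space $\mathcal{A}_{A_n}$. It is the positive space with one coordinate system $\{A_{ij}:\{ij\}\in T\}$ for each complete triangulation $T$, with transition maps generated by the Plücker relations $A_{ik}A_{jl}=A_{ij}A_{kl}+A_{il}A_{jk}$ ($i,j,k,l$ seated clockwise) and $A_{ij}=1$ for edges. $\mathbb{L}_+(\mathcal{A}_{A_n})$ is the set of functions that are Laurent polynomials with non-negative integer coefficients in every one of these coordinate systems; $\mathbf{E}(\mathcal{A}_{A_n})$ is the set of nonzero elements of $\mathbb{L}_+(\mathcal{A}_{A_n})$ that are not a sum of two nonzero elements of $\mathbb{L}_+(\mathcal{A}_{A_n})$. Tropical points. A point $x\in\mathcal{A}_{A_n}(\mathbb{A}^t)$ is a collection of numbers $A_{ij}^t(x)\in\mathbb{A}$, one for each segment, with $A_{ij}^t(x)=0$ for edges and $A_{ik}^t(x)+A_{jl}^t(x)=\max\{A_{ij}^t(x)+A_{kl}^t(x),A_{il}^t(x)+A_{jk}^t(x)\}$ for $i,j,k,l$ seated clockwise; for each complete $T$ the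 values on $T$ give a bijection $\mathcal{A}_{A_n}(\mathbb{A}^t)\simeq\mathbb{A}^n$. For nonzero $F\in\mathbb{L}_+(\mathcal{A}_{A_n})$, $F^t(x)$ is the maximum, over the monomials $\prod A_{ij}^{m_{ij}}$ occurring in the expansion of $F$ in any one coordinate system, of $\sum m_{ij}A_{ij}^t(x)$. Convexity. For $S\subseteq\mathcal{A}_{A_n}(\mathbb{A}^t)$ let $c_{F,S}=\sup_{x\in S}F^t(x)$ and $C(S)=\{x : F^t(x)\le c_{F,S}\ \forall F\in\mathbf{E}(\mathcal{A}_{A_n})\}$. $S$ is convex if $S=C(S)$. Stasheff polytopes. Let $c=\{c_{ij}\}$ be real numbers indexed by the diagonals. For a partial triangulation $T$, let $S(T)$ be the set of diagonals not in $T$ crossing no element of $T$, and $\mathcal{F}_c^T=\{x\in\mathcal{A}_{A_n}(\mathbb{R}^t) : A_{ij}^t(x)=c_{ij}\ \forall\{ij\}\in T,\ A_{ij}^t(x)\le c_{ij}\ \forall\{ij\}\in S(T)\}$. In particular $\mathcal{F}_c^\emptyset$ is defined by $A_{ij}^t(x)\le c_{ij}$ for all diagonals. $\mathcal{F}_c^\emptyset$ is a Stasheff polytope if $T_1\subseteq T_2$ implies $\mathcal{F}_c^{T_2}\subseteq\mathcal{F}_c^{T_1}$ for all partial triangulations $T_1,T_2$. By abuse of notation, the intersection $\mathcal{A}_{A_n}(\mathbb{A}^t)\cap\mathcal{F}_c^\emptyset$ is then called a Stasheff polytope in $\mathcal{A}_{A_n}(\mathbb{A}^t)$. *)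

(* Defs.v *)
From HB Require Import structures.
From mathcomp Require Import all_boot all_order all_algebra finmap.
From mathcomp Require Import boolp classical_sets reals ereal.

Set Implicit Arguments.
Unset Strict Implicit.
Unset Printing Implicit Defensive.

Import Order.TTheory GRing.Theory Num.Theory.

Local Open Scope classical_set_scope.
Local Open Scope ring_scope.

(* The vertices 1, ..., n+3, labeled clockwise, are the ordinals 0, ..., n+2;
   ordS is the next vertex clockwise. *)
Definition vertex (n : nat) := 'I_n.+3.

Definition segment (n : nat) := {s : {set vertex n} | #|s| == 2%N}.

Definition is_edge n (s : segment n) : bool :=
  [exists i : vertex n, val s == [set i; ordS i]%SET].

Definition is_diagonal n (s : segment n) : bool := ~~ is_edge s.

Definition seated_clockwise n (i j k l : vertex n) : bool :=
  [|| (i < j < k)%N && (k < l)%N, (j < k < l)%N && (l < i)%N,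
      (k < l < i)%N && (i < j)%N | (l < i < j)%N && (j < k)%N].

Definition crossing n (s t : segment n) : bool :=
  [exists i : vertex n, exists j : vertex n,
     exists k : vertex n, exists l : vertex n,
     [&& seated_clockwise i j k l,
         val s == [set i; k]%SET & val t == [set j; l]%SET]].

Definition partial_triangulation n (T : {set segment n}) : bool :=
  [forall s in T, is_diagonal s] &&
  [forall s in T, forall t in T, ~~ crossing s t].

Definition complete_triangulation n (T : {set segment n}) : bool :=
  maxset (@partial_triangulation n) T.

Definition coordinate_system (n : nat) :=
  {T : {set segment n} | complete_triangulation T}.

(* The value a_ij of a family a indexed by the segments.  The default 0 is
   returned only when i = j, which never happens for vertices seated
   clockwise. *)
Definition at_seg (V : nmodType) n (a : segment n -> V) (i j : vertex n) : V :=
  if insub [set i; j]%SET is Some s then a s else 0.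

(* The positive space is handled through its positive real points: on these,
   the coordinates of every complete triangulation identify the space with
   (R_{>0})^n, and the transition maps are those forced by the Pluecker
   relations. *)
Definition positive_points (R : realType) n : set (segment n -> R) :=
  [set a | (forall s, 0 < a s) /\
           (forall s, is_edge s -> a s = 1) /\
           (forall i j k l : vertex n, seated_clockwise i j k l ->
              at_seg a i k * at_seg a j l =
              at_seg a i j * at_seg a k l + at_seg a i l * at_seg a j k)].

(* Formal Laurent polynomials with non-negative integer coefficients: finitely
   supported maps from exponent vectors to coefficients. *)
Definition exponent (n : nat) := {ffun segment n -> int}.

Definition laurent (n : nat) := {fsfun exponent n -> nat with 0%N}.

Definition laurent_on n (T : {set segment n}) (P : laurent n) : Prop :=
  forall m : exponent n, m \in finsupp P ->
  forall s : segment n, s \notin T -> m s = 0.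

Definition laurent_eval (R : realType) n (T : {set segment n}) (P : laurent n)
    (a : segment n -> R) : R :=
  \sum_(m <- finsupp P) (P m)%:R * \prod_(s in T) a s ^ m s.

(* A function on the positive space is given by its expansions in all the
   coordinate systems.  It is well defined when these are related by the
   transition maps, i.e. take the same value at each positive point; distinct
   Laurent polynomials in the coordinates of T are distinct functions on
   (R_{>0})^n, so such a family is the same thing as the function itself. *)
Definition expansions (n : nat) := coordinate_system n -> laurent n.

Definition Lplus (R : realType) n : set (expansions n) :=
  [set F | (forall T : coordinate_system n, laurent_on (val T) (F T)) /\
           (forall (T T' : coordinate_system n) (a : segment n -> R),
              positive_points a ->
              laurent_eval (val T) (F T) a = laurent_eval (val T') (F T') a)].

Definition nonzero n (F : expansions n) : Prop :=
  exists (T : coordinate_system n) (m : exponent n), F T m <> 0%N.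

Definition is_sum n (F G H : expansions n) : Prop :=
  forall (T : coordinate_system n) (m : exponent n),
    F T m = (G T m + H T m)%N.

Definition indecomposable (R : realType) n : set (expansions n) :=
  [set F | Lplus R F /\ nonzero F /\
           ~ (exists G H : expansions n,
                [/\ Lplus R G, nonzero G, Lplus R H, nonzero H
                  & is_sum F G H])].

Inductive number_system := Integers | Rationals | Reals.

(* Z, Q and R are all regarded as subsets of R, so that points over Z or Q are
   literally points over R. *)
Definition numbers (R : realType) (A : number_system) : set R :=
  match A with
  | Integers => [set r | r \is a Num.int]
  | Rationals => range (@ratr R)
  | Reals => setT
  end.

Definition tropical_points (R : realType) n (A : number_system) :
    set (segment n -> R) :=
  [set x | (forall s, numbers A (x s)) /\
           (forall s, is_edge s -> x s = 0) /\
           (forall i j k l : vertex n, seated_clockwise i j k l ->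
              at_seg x i k + at_seg x j l =
              Num.max (at_seg x i j + at_seg x k l)
                      (at_seg x i l + at_seg x j k))].

(* F^t(x), computed in the coordinate system T; it is a real number when F is
   a nonzero element of Lplus. *)
Definition tropical (R : realType) n (T : coordinate_system n)
    (F : expansions n) (x : segment n -> R) : \bar R :=
  \big[maxe/-oo%E]_(m <- finsupp (F T)) (\sum_(s in val T) x s *~ m s)%:E.

Definition support_bound (R : realType) n (T : coordinate_system n)
    (F : expansions n) (S : set (segment n -> R)) : \bar R :=
  ereal_sup [set tropical T F x | x in S].

Definition hull (R : realType) n (A : number_system) (T : coordinate_system n)
    (S : set (segment n -> R)) : set (segment n -> R) :=
  [set x | tropical_points A x /\
           (forall F, indecomposable R F ->
              (tropical T F x <= support_bound T F S)%E)].

Definition convex (R : realType) n (A : number_system)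
    (T : coordinate_system n) (S : set (segment n -> R)) : Prop :=
  S = hull A T S.

Definition minkowski_sum (R : realType) n (A : number_system)
    (T : coordinate_system n) (m : nat) (l : 'I_m -> segment n -> R) :
    set (segment n -> R) :=
  [set x | tropical_points A x /\
           (forall F, indecomposable R F ->
              (tropical T F x <= \sum_(k < m) tropical T F (l k))%E)].

Definition free_diagonals n (T : {set segment n}) : {set segment n} :=
  [set s | [&& is_diagonal s, s \notin T
             & [forall t in T, ~~ crossing s t]]]%SET.

(* Only the values of c at diagonals matter. *)
Definition face (R : realType) n (c : segment n -> R) (T : {set segment n}) :
    set (segment n -> R) :=
  [set x | tropical_points Reals x /\
           (forall s, s \in T -> x s = c s) /\
           (forall s, s \in free_diagonals T -> x s <= c s)].

Definition stasheff (R : realType) n (c : segment n -> R) : Prop :=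
  forall T1 T2 : {set segment n},
    partial_triangulation T1 -> partial_triangulation T2 ->
    T1 \subset T2 -> face c T2 `<=` face c T1.

(* Main.v *)
Require Import Defs.
From HB Require Import structures.
From mathcomp Require Import all_boot all_order all_algebra finmap.
From mathcomp Require Import boolp classical_sets reals ereal.
From mathcomp Require Import sequences exp.
From mathcomp Require Import zify ring lra.

Set Implicit Arguments.
Unset Strict Implicit.
Unset Printing Implicit Defensive.

Import Order.TTheory GRing.Theory Num.Theory.

Local Open Scope classical_set_scope.
Local Open Scope ring_scope.

(** Two properties of a tropical point [x] give everything but one inclusion.

    A chord [cd] crossing [ab] gives [x_ab + x_cd] as the maximum of two sums
    over the sides of the quadrilateral [acbd], and these sides cross fewer
    chords of any triangulation that contains [cd].  Induction on the number of
    crossings ([crossing_ind]) then proves inequalities between a tropical point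
    and the numbers [c], since a sum [c] of tropical points satisfies the
    exchange relation with an inequality in the right direction
    ([tropical_sub]).  This is the Stasheff property.

    A tropical point that is bounded by another one is equal to it
    ([tropical_rigid]): the difference satisfies a chain of inequalities that
    starts and ends with opposite signs.  Since each [A_ij] is an indecomposable
    function, with tropicalization [x |-> x_ij] ([variable_ex],
    [tropical_variable]), single points are convex and the Minkowski sum is
    contained in the polytope.

    The opposite inclusion asks that [F^t(x) <= \sum_k F^t(l_k)] as soon as
    [x_ij <= \sum_k l_k,ij] for all diagonals.  This holds for every nonzero [F]
    in [L_+] ([tropical_sum_le]).  Indeed, if [F^t(x)] is the value of a monomial
    with exponents [m >= 0] in some coordinate system [T], then
    [F^t(x) = \sum m_ij x_ij <= \sum_k \sum m_ij l_k,ij <= \sum_k F^t(l_k)].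
    To find such a monomial, perturb [x] to a vector [z] that satisfies all
    exchange relations with a strict inequality, and choose [T] and [m] so as to
    maximize [\sum m_ij z_ij] over all monomials of all expansions of [F].  Were
    [m] negative on a diagonal of [T], flipping this diagonal would
    produce a larger value ([flip_gain]), as in the simplex method.

    The flip compares the expansions of [F] in two coordinate systems, and all
    that is used of them is that they take the same values at positive points.
    Their tropical values agree because positive points with coordinates close to
    [exp (N w_ij)] exist for every [N], and [F] grows along them like
    [exp (N F^t(w))] ([tropical_le]).  Such points are built by prescribing the
    values on one triangulation arbitrarily ([realize]). *)

(** * Segments, cyclic order and crossings *)

Definition seg01 n : segment n :=
  exist (fun s : {set vertex n} => #|s| == 2%N) [set ord0; ord_max]%SET
    (introT eqP (cards2 ord0 ord_max)).

(** The segment [ij].  The default value [seg01] is returned when [i = j]. *)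
Definition seg n (i j : vertex n) : segment n :=
  insubd (seg01 n) [set i; j]%SET.

Lemma ltn_vertex_neq n (i j : vertex n) : (i < j)%N -> i != j.
Proof. by move=> ij; apply: contraTneq ij => ->; rewrite ltnn. Qed.

Lemma val_seg n (i j : vertex n) : i != j -> val (seg i j) = [set i; j]%SET.
Proof. by move=> ij; rewrite val_insubd cards2 ij. Qed.

Lemma segC n (i j : vertex n) : seg i j = seg j i.
Proof. by rewrite /seg finset.setUC. Qed.

Lemma at_segE (V : nmodType) n (a : segment n -> V) (i j : vertex n) :
  i != j -> at_seg a i j = a (seg i j).
Proof.
move=> ij; rewrite /at_seg /seg /insubd.
by case: insubP => //=; rewrite cards2 ij.
Qed.

Lemma set2_eqP n (i j k l : vertex n) : i != j ->
  reflect ((i = k /\ j = l) \/ (i = l /\ j = k))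
          ([set i; j]%SET == [set k; l]%SET).
Proof.
move=> ij; apply: (iffP eqP) => [E|]; last first.
  by case=> -[-> ->] //; rewrite finset.setUC.
have : i \in [set k; l]%SET by rewrite -E !inE eqxx.
have : j \in [set k; l]%SET by rewrite -E !inE eqxx orbT.
rewrite !inE => /orP[]/eqP jE /orP[]/eqP iE; subst; auto.
  by rewrite eqxx in ij.
by rewrite eqxx in ij.
Qed.

Lemma seg_eqP n (i j k l : vertex n) : i != j -> k != l ->
  reflect ((i = k /\ j = l) \/ (i = l /\ j = k)) (seg i j == seg k l).
Proof.
by move=> ij kl; rewrite -val_eqE /= !val_seg //; apply: set2_eqP.
Qed.

Lemma seg_share_neq n (a b c : vertex n) :
  a != b -> a != c -> b != c -> seg a b != seg a c.
Proof.
by move=> ab ac bc; apply/seg_eqP => // -[] [e1 e2]; subst; rewrite eqxx in bc ac.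
Qed.

Lemma segP n (s : segment n) :
  exists i j : vertex n, (i < j)%N /\ s = seg i j.
Proof.
have /cards2P[i [j [ij E]]] := valP s.
have [lt|lt|/val_inj eq] := ltngtP i j; last by rewrite eq eqxx in ij.
  by exists i, j; split=> //; apply: val_inj; rewrite val_seg.
exists j, i; split=> //; apply: val_inj.
by rewrite val_seg ?(eq_sym j) // E finset.setUC.
Qed.

Lemma val_ordS n (k : vertex n) :
  ordS k = (if k == n.+2 :> nat then 0 else k.+1)%N :> nat.
Proof.
rewrite /=; have := ltn_ord k; case: eqP => [-> _|kn lt].
  by rewrite modnn.
by rewrite modn_small //; lia.
Qed.

Lemma ord_inE n (i j : vertex n) : (i == j) = (i == j :> nat).
Proof. by []. Qed.

Lemma is_edgeE n (i j : vertex n) : (i < j)%N ->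
  is_edge (seg i j) =
  (j == i.+1 :> nat) || ((i == 0 :> nat) && (j == n.+2 :> nat)).
Proof.
move=> lt; have ij : i != j by rewrite ord_inE; lia.
have lti := ltn_ord i; have ltj := ltn_ord j.
apply/existsP/idP => [[k]|].
  rewrite val_seg // => /set2_eqP-/(_ ij)[] [ek ej]; have := val_ordS k.
  - by rewrite -ej -ek; case: ifP; lia.
  - by rewrite -ek -ej; case: ifP; lia.
case/orP => [e|e]; [exists i|exists j]; rewrite val_seg //;
  apply/set2_eqP => //; [left|right]; split=> //; apply: ord_inj;
  rewrite val_ordS; case: ifP; lia.
Qed.

Lemma is_edge_ordS n (i : vertex n) : is_edge (seg i (ordS i)).
Proof.
have lti := ltn_ord i.
apply/existsP; exists i; rewrite val_seg // ord_inE; have := val_ordS i.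
by case: ifP; lia.
Qed.

Lemma clockwise_neq n (i j k l : vertex n) : seated_clockwise i j k l ->
  [/\ i != j, i != k, i != l & [/\ j != k, j != l & k != l]].
Proof. by rewrite /seated_clockwise !ord_inE => h; split; [| | |split]; lia. Qed.

Lemma crossingE n (a b c d : vertex n) : a != b -> c != d ->
  crossing (seg a b) (seg c d) =
  seated_clockwise a c b d || seated_clockwise a d b c.
Proof.
move=> ab cd; apply/idP/idP; last first.
  move=> H; apply/existsP; exists a; case/orP: H => H.
    apply/existsP; exists c; apply/existsP; exists b; apply/existsP; exists d.
    by rewrite H !val_seg ?eqxx.
  apply/existsP; exists d; apply/existsP; exists b; apply/existsP; exists c.
  by rewrite H (segC c) !val_seg ?eqxx // eq_sym.
case/existsP => i /existsP[j /existsP[k /existsP[l]]] /and3P[].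
rewrite !val_seg // => H /set2_eqP-/(_ ab) h1 /set2_eqP-/(_ cd) h2.
by case: h1 => -[-> ->]; case: h2 => -[-> ->]; move: H;
  rewrite /seated_clockwise; lia.
Qed.

(** [j] lies on the open arc that runs clockwise from [i] to [k]. *)
Definition between n (i j k : vertex n) : bool :=
  [|| (i < j < k)%N, (j < k < i)%N | (k < i < j)%N].

Lemma between_rot n (i j k : vertex n) : between i j k = between j k i.
Proof. by rewrite /between orbC -orbA orbC -!orbA; congr [|| _, _ | _]; lia. Qed.

Lemma between_neq n (i j k : vertex n) : between i j k ->
  [/\ i != j, j != k & i != k].
Proof. by case/or3P => h; split; rewrite ord_inE; lia. Qed.

Lemma between_asym n (i j k : vertex n) : between i j k -> ~~ between k j i.
Proof. by case/or3P => h; rewrite /between; lia. Qed.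

Lemma clockwiseE n (i j k l : vertex n) :
  seated_clockwise i j k l = between i j k && between i k l.
Proof.
apply/idP/andP => [/or4P[] /andP[h h']|[/or3P[] h /or3P[] h']];
  rewrite /between /seated_clockwise; try split; lia.
Qed.

Lemma crossing_ex n (s t : segment n) : crossing s t ->
  exists i j k l : vertex n,
    [/\ seated_clockwise i j k l, s = seg i k & t = seg j l].
Proof.
case/existsP => i /existsP[j /existsP[k /existsP[l]]] /and3P[h /eqP si /eqP tj].
exists i, j, k, l; have [_ ik _ [_ jl _]] := clockwise_neq h.
by split=> //; apply: val_inj; rewrite val_seg.
Qed.

Lemma crossing_sym n (s t : segment n) : crossing s t = crossing t s.
Proof.
have [i [j [ij ->]]] := segP s; have [k [l [kl ->]]] := segP t.
rewrite !crossingE ?ord_inE /seated_clockwise; lia.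
Qed.

Lemma crossing_irr n (s : segment n) : crossing s s = false.
Proof.
have [i [j [ij ->]]] := segP s.
rewrite !crossingE ?ord_inE /seated_clockwise; lia.
Qed.

Lemma crossing_diagonal n (s t : segment n) : crossing s t -> is_diagonal s.
Proof.
have [i [j [ij ->]]] := segP s; have [k [l [kl ->]]] := segP t.
rewrite /is_diagonal is_edgeE // !crossingE ?ord_inE /seated_clockwise; try lia.
by have := ltn_ord l; have := ltn_ord k; lia.
Qed.

Lemma partialP n (T : {set segment n}) :
  reflect ((forall s, s \in T -> is_diagonal s) /\
           (forall s t, s \in T -> t \in T -> ~~ crossing s t))
          (partial_triangulation T).
Proof.
apply: (iffP andP) => -[h1 h2]; split.
- by move=> s; apply/implyP/(forallP h1).
- move=> s t sT tT; move/forall_inP/(_ s sT)/forall_inP: h2; exact.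
- exact/forall_inP.
- by apply/forall_inP => s sT; apply/forall_inP => t tT; apply: h2.
Qed.

Lemma completeP n (T : {set segment n}) :
  complete_triangulation T <->
  partial_triangulation T /\
  (forall u, is_diagonal u -> (forall t, t \in T -> ~~ crossing u t) -> u \in T).
Proof.
split=> [/maxsetP[pT maxT]|[pT maxT]].
  split=> // u du uT; have [dT cT] := partialP _ pT.
  rewrite -(maxT (u |: T)%SET); first by rewrite !finset.inE eqxx.
    apply/partialP; split=> [s|s t]; rewrite !finset.inE.
      by case/orP => [/eqP->|/dT].
    case/orP => [/eqP->|sT] /orP[/eqP->|tT]; rewrite ?crossing_irr //.
    - exact: uT.
    - by rewrite crossing_sym uT.
    - exact: cT.
  exact: finset.subsetUr.
apply/maxsetP; split=> // B /partialP[dB cB] TB.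
apply/eqP; rewrite finset.eqEsubset TB andbT; apply/fintype.subsetP => u uB.
by apply: maxT (dB _ uB) _ => t tT; apply: cB => //; apply: (fintype.subsetP TB).
Qed.

Lemma crossing_between n (a b c d : vertex n) : a != b -> c != d ->
  crossing (seg a b) (seg c d) =
  between a c b && between b d a || between a d b && between b c a.
Proof.
move=> ab cd; rewrite crossingE // !clockwiseE.
have e x y : between a x b && between a b y = between a x b && between b y a.
  by rewrite (between_rot a b y).
by rewrite !e.
Qed.

Lemma crossing_segP n (a b : vertex n) (t : segment n) : a != b ->
  crossing (seg a b) t ->
  exists p q, [/\ t = seg p q, between a p b & between b q a].
Proof.
move=> ab; have [p [q [pq ->]]] := segP t.
have pq' : p != q by rewrite ord_inE; lia.
rewrite crossing_between // => /orP[] /andP[h1 h2].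
  by exists p, q.
by exists q, p; rewrite segC.
Qed.

Lemma crossing_share n (a b c : vertex n) : a != b -> a != c ->
  crossing (seg a b) (seg a c) = false.
Proof.
move=> ab ac; rewrite crossing_between //.
by apply/negP => /orP[] /andP[/between_neq[h1 h2 h3] /between_neq[h4 h5 h6]];
   rewrite ?eqxx in h1 h2 h3 h4 h5 h6.
Qed.

(** Measuring clockwise distances from [a] turns the cyclic order into the order
    of the integers with [a] as its least element, so that arguments about
    chords leaving [a] become linear arithmetic with few cases. *)
Lemma cut_order n (a : vertex n) : exists f : vertex n -> nat,
  [/\ injective f, f a = 0%N,
      forall x y, (between a x y = (0 < f x < f y)%N) *
         (between x y a = (0 < f x < f y)%N) *
         (between x a y = (0 < f y < f x)%N) &
      forall x y z, between x y z = [|| (f x < f y < f z)%N,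
         (f y < f z < f x)%N | (f z < f x < f y)%N]].
Proof.
exists (fun x : vertex n => if (a <= x)%N then (x - a)%N else (x + n.+3 - a)%N).
have lta := ltn_ord a.
split=> [x y|||x y z]; rewrite /between.
- have := ltn_ord x; have := ltn_ord y.
  by case: ifP; case: ifP => h1 h2 h3 h4 h5; apply: ord_inj; lia.
- by rewrite leqnn subnn.
- move=> x y; have := ltn_ord x; have := ltn_ord y.
  by case: ifP; case: ifP => h1 h2 h3 h4; do !split; apply/idP/idP; lia.
have := ltn_ord x; have := ltn_ord y; have := ltn_ord z.
by case: ifP; case: ifP; case: ifP => h1 h2 h3 h4 h5 h6; apply/idP/idP; lia.
Qed.

(** A chord that crosses [ac] but not [cd] has one end between [a] and [c] and
    the other on the arc from [d] to [a]; as [b] is between [c] and [d], that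
    chord crosses [ab].  The case of [ad] is its mirror image. *)
Lemma crossing_side n (a b c d : vertex n) (t : segment n) :
  seated_clockwise a c b d -> ~~ crossing t (seg c d) ->
  crossing (seg a c) t || crossing (seg a d) t -> crossing (seg a b) t.
Proof.
move=> h ncd; have [ac ab ad [cb cd bd]] := clockwise_neq h.
rewrite crossing_sym in ncd.
move=> cr; have : exists p q, [/\ t = seg p q, p != q &
    (between a p c && between c q a) || (between a p d && between d q a)].
  case/orP: cr => /crossing_segP-/(_ _)[//|p [q [-> h1 h2]]]; exists p, q;
  (have pq : p != q by apply: contraTneq h1 => ->; apply: between_asym);
  by rewrite h1 h2 ?orbT.
case=> p [q [et pq H]]; rewrite et in ncd *.
rewrite crossing_between // in ncd.
rewrite crossing_between //.
have [f [finj fa f0 fE]] := cut_order a.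
have {}bd : f b != f d by rewrite (inj_eq finj).
have {}cb : f c != f b by rewrite (inj_eq finj).
move: h ncd H; rewrite clockwiseE; case/andP.
by rewrite !f0 !fE; lia.
Qed.

Lemma clockwise_rot n (i j k l : vertex n) :
  seated_clockwise i j k l = seated_clockwise j k l i.
Proof. by rewrite /seated_clockwise; lia. Qed.

(** By [crossing_side], the four sides [ac], [cb], [bd] and [ad] cross only
    chords of [T] that [ab] crosses, and they do not cross [cd] itself: the
    number of crossings with [T] goes down. *)
Lemma crossing_ind n (T : {set segment n}) (P : segment n -> Prop) :
  (forall s t, s \in T -> t \in T -> ~~ crossing s t) ->
  (forall s, (forall t, t \in T -> ~~ crossing s t) -> P s) ->
  (forall a b c d, seated_clockwise a c b d -> seg c d \in T ->
     P (seg a c) -> P (seg c b) -> P (seg b d) -> P (seg a d) ->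
     P (seg a b)) ->
  forall s, P s.
Proof.
move=> cT P0 PS s; have [k] := ubnP #|[set t in T | crossing s t]%SET|.
elim: k s => // k IH s; rewrite ltnS => sk.
have [/exists_inP[t tT st]|/exists_inPn] := boolP [exists t in T, crossing s t];
  last exact: P0.
have [a [c [b [d [h es et]]]]] := crossing_ex st.
have less u : u = seg a c \/ u = seg a d \/ u = seg c b \/ u = seg b d -> P u.
  move=> hu; apply: IH; apply: leq_trans sk; apply: proper_card.
  have h' : seated_clockwise b d a c by rewrite 2!clockwise_rot.
  have sub v : v \in T -> crossing u v -> crossing s v.
    move=> vT uv; have tv : ~~ crossing v (seg c d) by rewrite -et cT.
    have tv' : ~~ crossing v (seg d c) by rewrite segC.
    rewrite es; case: hu => [|[|[|]]] eu; move: uv; rewrite eu => uv.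
    - by apply: crossing_side h tv _; rewrite uv.
    - by apply: crossing_side h tv _; rewrite uv orbT.
    - by rewrite segC; apply: crossing_side h' tv' _; rewrite (segC b c) uv orbT.
    - by rewrite segC; apply: crossing_side h' tv' _; rewrite uv.
  apply/properP; split.
    apply/fintype.subsetP => v /setIdP[vT uv].
    by apply/setIdP; split; [exact: vT|exact: sub vT uv].
  exists t; rewrite !finset.inE tT //= et.
  have [n1 n2 n3 [n4 n5 n6]] := clockwise_neq h.
  case: hu => [|[|[|]]] ->.
  - by rewrite (segC a) crossing_share // eq_sym.
  - by rewrite (segC a) (segC c) crossing_share // eq_sym.
  - by rewrite crossing_share.
  - by rewrite (segC b) (segC c) crossing_share // eq_sym.
by rewrite es; apply: PS h _ _ _ _ _; rewrite -?et //; apply: less; auto.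
Qed.

(** * Triangles and flips *)

Definition side n (T : {set segment n}) (i j : vertex n) :=
  is_edge (seg i j) || (seg i j \in T).

Lemma sideC n (T : {set segment n}) (i j : vertex n) : side T i j = side T j i.
Proof. by rewrite /side segC. Qed.

Lemma side_ncross n (T : {set segment n}) i j t :
  partial_triangulation T -> side T i j -> t \in T -> ~~ crossing (seg i j) t.
Proof.
case/partialP => _ cT /orP[e|ijT] tT; last exact: cT.
by apply: contraTN e => /crossing_diagonal.
Qed.

(** The third vertex [j] is the last one on the arc that is joined to [i].  A
    chord of [T] that crosses [jk] crosses neither [ik] nor [ij], so it starts
    at [i] and ends beyond [j], against the choice of [j]; so [jk] is in [T] by
    maximality. *)
Lemma triangle_ex n (T : {set segment n}) (i k : vertex n) :
  complete_triangulation T -> side T i k -> between i (ordS i) k ->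
  exists j, [/\ between i j k, side T i j & side T j k].
Proof.
move=> /completeP[pT maxT] ikT bt.
pose Q j := between i j k && side T i j.
have [f [f_inj f0 fiE fE]] := cut_order i.
have Q0 : Q (ordS i) by rewrite /Q bt /side is_edge_ordS.
case: (arg_maxnP f Q0) => j /andP[bj ijT] maxj.
exists j; split=> //.
apply/orP; have [e|d] := boolP (is_edge _); [by left|right].
apply: maxT d _ => t tT; apply/negP => ct.
have [p [q [pq et]]] := segP t.
have pq' : p != q by apply: contraTneq pq => ->; rewrite ltnn.
have n1 := side_ncross pT ikT tT; have n2 := side_ncross pT ijT tT.
have key : (p == i) && between j q k || (q == i) && between j p k.
  have [ij' jk' ik'] := between_neq bj.
  move: bj n1 n2 ct; rewrite et !crossing_between //.
  rewrite -!(inj_eq f_inj) in ij' jk' ik' pq' *.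
  rewrite f0 in ij' ik' *; rewrite !fiE !fE; lia.
have [u [iuT bu]] : exists u, side T i u /\ between j u k.
  rewrite et in tT; case/orP: key => /andP[/eqP e b].
    by exists q; split=> //; rewrite -e /side tT orbT.
  by exists p; split=> //; rewrite -e sideC /side tT orbT.
clear n1 n2 ct key.
have Qu : Q u by rewrite /Q iuT andbT; move: bu bj; rewrite !fiE !fE; lia.
by have := maxj _ Qu; move: bu bj; rewrite !fiE !fE; lia.
Qed.

(** An end strictly between two neighbouring corners would force the chord to
    cross the side that joins them. *)
Lemma quad_crossing n (i j k l : vertex n) t :
  seated_clockwise i j k l -> crossing (seg i k) t ->
  ~~ crossing (seg i j) t -> ~~ crossing (seg j k) t ->
  ~~ crossing (seg k l) t -> ~~ crossing (seg i l) t -> t = seg j l.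
Proof.
move=> h; have [ij ik il [jk jl kl]] := clockwise_neq h.
case/(crossing_segP ik) => p [q [et ipk kqi]]; rewrite et.
have pq : p != q by apply: contraTneq kqi => <-; apply: between_asym.
rewrite !crossing_between // !negb_or.
move=> /andP[h1 _] /andP[h2 _] /andP[_ h3] /andP[h4 _].
have /andP[/eqP-> /eqP->] // : (p == j) && (q == l).
have [f [f_inj f0 fiE fE]] := cut_order i.
move: h ipk kqi h1 h2 h3 h4.
rewrite -!(inj_eq f_inj) clockwiseE !fiE !fE; clear; lia.
Qed.

(** By [quad_crossing], only [ik] among the chords of [T] crosses [jl], and
    conversely [jl] is the only new chord that fits once [ik] is removed. *)
Lemma flip_complete n (T : {set segment n}) (i j k l : vertex n) :
  complete_triangulation T -> seated_clockwise i j k l -> seg i k \in T ->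
  side T i j -> side T j k -> side T k l -> side T i l ->
  complete_triangulation (seg j l |: T :\ seg i k)%SET.
Proof.
move=> /completeP[pT maxT] h ikT ij jk kl il.
have [dT cT] := partialP _ pT.
have [nij nik nil [njk njl nkl]] := clockwise_neq h.
have hjl : crossing (seg i k) (seg j l) by rewrite crossingE // h.
have h' : seated_clockwise j k l i by rewrite -clockwise_rot.
apply/completeP; split.
  have ncr t : t \in (T :\ seg i k)%SET -> ~~ crossing (seg j l) t.
    rewrite !finset.inE => /andP[tik tT]; apply: contra tik => ct; apply/eqP.
    by rewrite segC; apply: quad_crossing h' ct _ _ _ _ => //;
      apply: side_ncross pT _ tT; rewrite // sideC.
  apply/partialP; split=> [s|s t]; rewrite finset.in_setU1.
    case/orP => [/eqP->|]; last by rewrite !finset.inE => /andP[_ /dT].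
    by rewrite crossing_sym in hjl; apply: crossing_diagonal hjl.
  case/orP => [/eqP->|sT]; rewrite finset.in_setU1.
    by case/orP => [/eqP->|]; [rewrite crossing_irr|exact: ncr].
  case/orP => [/eqP->|tT]; first by rewrite crossing_sym ncr.
  by apply: cT; [case/setD1P: sT|case/setD1P: tT].
move=> u du uT.
have ujl : ~~ crossing u (seg j l) by rewrite uT // !finset.inE eqxx.
have uT' t : t \in T -> t != seg i k -> ~~ crossing u t.
  by move=> tT tik; apply: uT; rewrite !finset.inE tT tik orbT.
have [cu|ncu] := boolP (crossing (seg i k) u); last first.
  have uinT : u \in T.
    apply: maxT du _ => t tT; have [->|] := eqVneq t (seg i k); last exact: uT'.
    by rewrite crossing_sym.
  rewrite !finset.inE uinT andbT; have [eu|] := eqVneq u (seg i k); last by rewrite orbT.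
  by rewrite eu hjl in ujl.
have nside a b : side T a b -> seg a b != seg i k -> ~~ crossing (seg a b) u.
  case/orP => [e _|abT ab]; last by rewrite crossing_sym uT'.
  by apply: contraTN e => /crossing_diagonal.
rewrite !finset.inE; apply/orP; left; apply/eqP.
apply: quad_crossing h cu _ _ _ _; apply: nside => //.
- by apply: seg_share_neq.
- by rewrite segC (segC i); apply: seg_share_neq; rewrite 1?eq_sym.
- by rewrite (segC i); apply: seg_share_neq; rewrite 1?eq_sym // eq_sym.
- by apply: seg_share_neq; rewrite // eq_sym.
Qed.

(** * Inequalities between tropical points *)

Lemma tropical_points_real (R : realType) n A (x : segment n -> R) :
  tropical_points A x -> tropical_points Reals x.
Proof. by case=> _ h; split. Qed.

Lemma tropical_edge (R : realType) n A (x : segment n -> R) s :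
  tropical_points A x -> is_edge s -> x s = 0.
Proof. by case=> _ [+ _]; apply. Qed.

Lemma tropical_max (R : realType) n A (x : segment n -> R) (i j k l : vertex n) :
  tropical_points A x -> seated_clockwise i j k l ->
  x (seg i k) + x (seg j l) =
  Num.max (x (seg i j) + x (seg k l)) (x (seg i l) + x (seg j k)).
Proof.
move=> [_ [_ h]] cw; have [ij ik il [jk jl kl]] := clockwise_neq cw.
by have := h _ _ _ _ cw; rewrite !at_segE.
Qed.

Definition turn n (k : nat) (j : vertex n) : vertex n := iter k (@ordS _) j.

Lemma val_turn n (j : vertex n) k : (k < n.+3)%N ->
  turn k j = (if j + k < n.+3 then j + k else j + k - n.+3)%N :> nat.
Proof.
have ltj := ltn_ord j.
elim: k => [|k IH] lt; first by rewrite addn0 ltj.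
rewrite /turn iterS -/(turn _ _) val_ordS IH ?(ltnW lt) //.
by case: ifP; case: ifP; case: ifP; lia.
Qed.

Lemma turn_clockwise n (j : vertex n) a b c : (0 < a < b)%N -> (b < c < n.+3)%N ->
  seated_clockwise j (turn a j) (turn b j) (turn c j).
Proof.
move=> h1 h2; have ltj := ltn_ord j.
rewrite /seated_clockwise !val_turn; try lia.
by case: ifP; case: ifP; case: ifP; lia.
Qed.

(** Let [d = x - l <= 0], which vanishes on the edges.  For two edges [ii'] and
    [jj'] the relation reads [x_ij + x_i'j' = max(0, x_ij' + x_i'j)], and it gives
    [d_ij' + d_i'j <= d_ij + d_i'j'] whatever the sign of [l_ij' + l_i'j].  Hence
    [d_ij' - d_ij], for fixed consecutive [j] and [j'], increases as [i] turns
    clockwise from [j'] to [j].  It is [- d_jj'' >= 0] at the vertex [j''] after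
    [j'] and [d_hj' <= 0] at the vertex [h] before [j], so it is [0] for all
    [i], and [d_ij] does not depend on [j]: it is its value [0] on an edge. *)
Lemma tropical_rigid (R : realType) n (x l : segment n -> R) :
  tropical_points Reals x -> tropical_points Reals l ->
  (forall s, x s <= l s) -> x = l.
Proof.
move=> tx tl xl.
have ex s := tropical_edge (s := s) tx.
have el s := tropical_edge (s := s) tl.
pose d s := x s - l s.
have d0 s : d s <= 0 by rewrite subr_le0.
have de s : is_edge s -> d s = 0 by move=> es; rewrite /d ex // el // subrr.
have quad (i i' j j' : vertex n) : seated_clockwise i i' j j' ->
    is_edge (seg i i') -> is_edge (seg j j') ->
    d (seg i j') + d (seg i' j) <= d (seg i j) + d (seg i' j').
  move=> cw e1 e2; have := tropical_max tx cw; have := tropical_max tl cw.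
  rewrite !(ex _ e1) !(el _ e1) !(ex _ e2) !(el _ e2) /d !addr0.
  have := xl (seg i j); have := xl (seg i' j').
  have := xl (seg i j'); have := xl (seg i' j).
  by rewrite /Num.max; case: ltP => ?; case: ltP => ? ? ? ? ? ? ?; lra.
have step (j : vertex n) k : (1 < k)%N -> (k < n.+2)%N ->
    d (seg (turn k j) (ordS j)) - d (seg (turn k j) j) <=
    d (seg (turn k.+1 j) (ordS j)) - d (seg (turn k.+1 j) j).
  move=> k1 k2.
  have cw : seated_clockwise j (ordS j) (turn k j) (turn k.+1 j).
    by apply: (@turn_clockwise _ j 1 k k.+1); lia.
  have := quad _ _ _ _ cw (is_edge_ordS _) (is_edge_ordS _).
  by rewrite !(segC (turn _ _)); lra.
have chain (j : vertex n) k m : (1 < k)%N -> (k <= m)%N -> (m < n.+3)%N ->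
    d (seg (turn k j) (ordS j)) - d (seg (turn k j) j) <=
    d (seg (turn m j) (ordS j)) - d (seg (turn m j) j).
  move=> k1; elim: m => [|m IH]; first by move=> /(leq_trans k1).
  rewrite leq_eqVlt => /orP[/eqP-> //|km mn].
  by apply: le_trans (IH _ _) (step _ _ _ _); lia.
have flat (j : vertex n) k : (1 < k < n.+3)%N ->
    d (seg (turn k j) (ordS j)) = d (seg (turn k j) j).
  case/andP => k1 kn; have c1 := @chain j 2%N k isT k1 kn.
  have c2 := @chain j k n.+2 k1 kn (ltnSn _).
  have e1 : d (seg (turn 2%N j) (ordS j)) = 0 by rewrite segC de ?is_edge_ordS.
  have e2 : d (seg (turn n.+2 j) j) = 0.
    suff {2}<- : turn n.+3 j = j by rewrite de // is_edge_ordS.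
    apply: ord_inj; rewrite /turn iterS -/(turn _ _) val_ordS val_turn //.
    have := ltn_ord j.
    by case: ifP; case: ifP; lia.
  have := d0 (seg (turn 2%N j) j); have := d0 (seg (turn n.+2 j) (ordS j)).
  by lra.
have zero (i : vertex n) k : (k <= n)%N -> d (seg i (turn k.+1 i)) = 0.
  elim: k => [|k IH] kn; first by rewrite de ?is_edge_ordS.
  rewrite /turn iterS -/(turn _ _) -{}IH ?(ltnW kn) //.
  pose j := turn k.+1 i.
  have ei : i = turn (n.+3 - k.+1)%N j.
    apply: ord_inj; rewrite val_turn ?val_turn; try lia.
    by have := ltn_ord i; case: ifP; case: ifP; lia.
  by rewrite -/j {1 2}ei flat //; lia.
apply: funext => s; apply/eqP; rewrite -subr_eq0 -/(d s).
have [i [j [ij ->]]] := segP s; have ltj := ltn_ord j.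
have -> : j = turn (j - i)%N i.
  by apply: ord_inj; rewrite val_turn; [case: ifP; lia | lia].
have [e|ne] := eqVneq (j - i)%N n.+2.
  rewrite de // e segC; suff {2}-> : i = turn n.+3 i by apply: is_edge_ordS.
  apply: ord_inj; rewrite /turn iterS -/(turn _ _) val_ordS val_turn //.
  by case: ifP; case: ifP; lia.
have -> : (j - i)%N = (j - i).-1.+1 by lia.
by rewrite zero //; lia.
Qed.

(** Where [ab] crosses [cd] in [T], the equality [x_cd = y_cd] can be cancelled:
    [x_ab + x_cd] is a maximum of sums that are bounded, by induction, by the
    same sums for [y], hence by [y_ab + y_cd]. *)
Lemma tropical_sub (R : realType) n (T : {set segment n}) (x y : segment n -> R) :
  partial_triangulation T -> tropical_points Reals x ->
  (forall s, is_edge s -> y s = 0) ->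
  (forall i j k l, seated_clockwise i j k l ->
     Num.max (y (seg i j) + y (seg k l)) (y (seg i l) + y (seg j k)) <=
     y (seg i k) + y (seg j l)) ->
  (forall s, s \in T -> x s = y s) ->
  (forall s, s \in free_diagonals T -> x s <= y s) ->
  forall s, x s <= y s.
Proof.
move=> pT tx ye ysup xT xfree; have [dT cT] := partialP _ pT.
have xe s := tropical_edge (s := s) tx.
apply: (crossing_ind cT) => [s ncs|a b c d cw cdT h1 h2 h3 h4].
  have [e|ne] := boolP (is_edge s); first by rewrite xe // ye.
  have [sT|sT] := boolP (s \in T); first by rewrite xT.
  apply: xfree; rewrite finset.in_set sT /is_diagonal ne /=.
  by apply/forall_inP.
have := ysup _ _ _ _ cw; rewrite ge_max => /andP[].
have := tropical_max tx cw; have := xT _ cdT; move: h1 h2 h3 h4.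
by rewrite /Num.max; case: ltP => _; lra.
Qed.

Lemma stasheff_super (R : realType) n (c y : segment n -> R) :
  (forall s, is_diagonal s -> c s = y s) ->
  (forall s, is_edge s -> y s = 0) ->
  (forall i j k l, seated_clockwise i j k l ->
     Num.max (y (seg i j) + y (seg k l)) (y (seg i l) + y (seg j k)) <=
     y (seg i k) + y (seg j l)) ->
  stasheff c.
Proof.
move=> cy ye ysup T1 T2 p1 p2 T12 x [tx [xT xfree]].
have [dT _] := partialP _ p2.
have le : forall s, x s <= y s.
  apply: (tropical_sub p2 tx ye ysup) => s sT; first by rewrite xT // cy ?dT.
  by rewrite -cy ?xfree //; move: sT; rewrite finset.in_set => /and3P[].
split=> //; split=> s; first by move=> /(fintype.subsetP T12); apply: xT.
by rewrite finset.in_set => /and3P[ds _ _]; rewrite cy.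
Qed.

(** * Positive points with prescribed coordinates *)

Lemma clockwise_incr n (P : vertex n -> vertex n -> vertex n -> vertex n -> Prop) :
  (forall i j k l, P i j k l -> P j k l i) ->
  (forall i j k l : vertex n, (i < j)%N -> (j < k)%N -> (k < l)%N -> P i j k l) ->
  forall i j k l, seated_clockwise i j k l -> P i j k l.
Proof.
move=> rot incr i j k l /or4P[] /andP[/andP[h1 h2] h3].
- exact: incr.
- exact: rot _ _ _ _ (rot _ _ _ _ (rot _ _ _ _ (incr _ _ _ _ h1 h2 h3))).
- exact: rot _ _ _ _ (rot _ _ _ _ (incr _ _ _ _ h1 h2 h3)).
- exact: rot _ _ _ _ (incr _ _ _ _ h1 h2 h3).
Qed.

Lemma positive_pointsP (R : realType) n (a : segment n -> R) :
  (forall s, 0 < a s) -> (forall s, is_edge s -> a s = 1) ->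
  (forall i j k l : vertex n, (i < j)%N -> (j < k)%N -> (k < l)%N ->
     a (seg i k) * a (seg j l) =
     a (seg i j) * a (seg k l) + a (seg i l) * a (seg j k)) ->
  positive_points a.
Proof.
move=> a0 ae pl; split=> //; split=> // i j k l cw.
have [ij ik il [jk jl kl]] := clockwise_neq cw; rewrite !at_segE //.
move: i j k l cw {ij ik il jk jl kl}; apply: clockwise_incr => [i j k l|] //.
by rewrite (segC k i) (segC l i) (segC j i); lra.
Qed.

Lemma plucker (R : realType) n (a : segment n -> R) (i j k l : vertex n) :
  positive_points a -> seated_clockwise i j k l ->
  a (seg i k) * a (seg j l) =
  a (seg i j) * a (seg k l) + a (seg i l) * a (seg j k).
Proof.
move=> [_ [_ h]] cw; have [ij ik il [jk jl kl]] := clockwise_neq cw.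
by have := h _ _ _ _ cw; rewrite !at_segE.
Qed.

Lemma chord_fun (R : Type) n (D : vertex n -> vertex n -> R) :
  exists a : segment n -> R, forall i j : vertex n, (i < j)%N -> a (seg i j) = D i j.
Proof.
have /choice[a aE] : forall s : segment n, exists v : R,
    forall i j : vertex n, (i < j)%N -> s = seg i j -> v = D i j.
  move=> s; have [k [l [kl es]]] := segP s; exists (D k l) => i j ij e.
  have /seg_eqP : seg k l == seg i j by rewrite -e -es.
  case; rewrite ?ltn_vertex_neq //; first by case=> -> ->.
  by case=> ei ej; move: ij kl; rewrite ei ej; lia.
by exists a => i j ij; apply: aE.
Qed.

(** The [2 x 2] minors of a [2 x (n + 3)] matrix, whose columns are [(p_i, q_i)],
    satisfy the Pluecker relations identically. *)
Lemma planar_point (R : realType) n (p q : vertex n -> R) :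
  (forall i j : vertex n, (i < j)%N -> 0 < p i * q j - q i * p j) ->
  (forall i j : vertex n, (i < j)%N -> is_edge (seg i j) ->
     p i * q j - q i * p j = 1) ->
  exists a : segment n -> R, positive_points a /\
    forall i j : vertex n, (i < j)%N -> a (seg i j) = p i * q j - q i * p j.
Proof.
move=> pos edge.
have [a aE] := chord_fun (fun i j : vertex n => p i * q j - q i * p j).
exists a; split=> //; apply: positive_pointsP => [s|s|i j k l ij jk kl].
- by have [i [j [ij ->]]] := segP s; rewrite aE ?pos.
- by have [i [j [ij ->]]] := segP s => e; rewrite aE ?edge.
have ik := ltn_trans ij jk; have jl := ltn_trans jk kl; have il := ltn_trans ij jl.
by rewrite !aE //; ring.
Qed.

(** The fan of chords at vertex [0]: plane vectors with prescribed
    determinants against the vector of vertex [0], the remaining freedom being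
    fixed by the requirement that consecutive vectors have determinant [1]. *)
Lemma realize_fan (R : realType) n (b : segment n -> R) :
  (forall s, 0 < b s) -> (forall s, is_edge s -> b s = 1) ->
  exists a : segment n -> R, positive_points a /\
    forall s : segment n, ord0 \in val s -> a s = b s.
Proof.
move=> b0 be.
pose B k := b (seg (ord0 : vertex n) (inord k)).
(* [th i] is the slope of the [i]-th vector [(B i, B i * th i)]; for the edge
   from [i] to [i + 1] the determinant is [B i * B i.+1 * (th i.+1 - th i)]. *)
pose th k := \sum_(1 <= m < k) (B m * B m.+1)^-1.
have B0 k : 0 < B k by exact: b0.
have thS k : (0 < k)%N -> th k.+1 = th k + (B k * B k.+1)^-1.
  by move=> k0; rewrite /th big_nat_recr.
have th_lt i j : (0 < i)%N -> (i < j)%N -> th i < th j.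
  move=> i0; elim: j => // j IH; rewrite ltnS leq_eqVlt => /orP[/eqP<-|ij].
    by rewrite thS // ltrDl invr_gt0 mulr_gt0.
  by rewrite (lt_trans (IH ij)) // thS ?(ltn_trans i0) // ltrDl invr_gt0 mulr_gt0.
pose p (i : vertex n) : R := if i == 0%N :> nat then 0 else B i.
pose q (i : vertex n) : R := if i == 0%N :> nat then -1 else B i * th i.
have det0 (i j : vertex n) : (i < j)%N -> i = 0%N :> nat ->
    p i * q j - q i * p j = b (seg i j).
  move=> ij i0; rewrite /p /q i0 eqxx; case: eqP => [j0|_].
    by rewrite i0 j0 in ij.
  have -> : i = ord0 by apply: ord_inj.
  by rewrite mul0r add0r mulN1r opprK /B inord_val.
have det1 (i j : vertex n) : (i < j)%N -> (0 < i)%N ->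
    p i * q j - q i * p j = B i * B j * (th j - th i).
  move=> ij i0; have j0 := ltn_trans i0 ij.
  by rewrite /p /q (gtn_eqF i0) (gtn_eqF j0); ring.
have [||a [ap aE]] := @planar_point R n p q.
- move=> i j ij; have [i0|i0] := posnP i; first by rewrite det0.
  by rewrite det1 // !mulr_gt0 // subr_gt0 th_lt.
- move=> i j ij e; have [i0|i0] := posnP i; first by rewrite det0 // be.
  rewrite det1 //; move: e; rewrite is_edgeE // (gtn_eqF i0) andFb orbF => /eqP->.
  by rewrite thS // addrC addKr mulfV // mulf_neq0 // gt_eqF.
exists a; split=> // s; have [i [j [ij ->]]] := segP s.
rewrite val_seg ?ltn_vertex_neq // !finset.inE => /orP[] /eqP e.
  by rewrite aE // det0 // -e.
by rewrite -e in ij.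
Qed.

Lemma between_ordS n (i k : vertex n) :
  i != k -> is_diagonal (seg i k) -> between i (ordS i) k.
Proof.
rewrite ord_inE => ik d; have ok : ordS i != k.
  by apply: contraTneq d => <-; rewrite /is_diagonal is_edge_ordS.
have lti := ltn_ord i; have ltk := ltn_ord k.
move: ok; rewrite ord_inE /between val_ordS; clear d.
by case: ifP => e; lia.
Qed.

Lemma quad_ex n (T : {set segment n}) (i k : vertex n) :
  complete_triangulation T -> i != k -> seg i k \in T ->
  exists j l, [/\ seated_clockwise i j k l,
    side T i j, side T j k, side T k l & side T i l].
Proof.
move=> cT ik ikT; have [pT _] := (completeP T).1 cT.
have [dT _] := partialP _ pT.
have sik : side T i k by rewrite /side ikT orbT.
have [j [b1 ij jk]] := triangle_ex cT sik (between_ordS ik (dT _ ikT)).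
have ki : k != i by rewrite eq_sym.
have kiT : seg k i \in T by rewrite segC.
have ski : side T k i by rewrite sideC.
have [l [b2 kl li]] := triangle_ex cT ski (between_ordS ki (dT _ kiT)).
exists j, l; split=> //; last by rewrite sideC.
by rewrite clockwiseE b1 -(between_rot l i k) -between_rot b2.
Qed.

(** Take the chord [ik] of [T], away from vertex [0], that cuts off the most
    vertices on the side opposite to [0].  The triangle on its other side has apex
    [0], since otherwise one of its two further sides would be a chord away from
    [0] that cuts off more. *)
Lemma quad_ord0 n (T : {set segment n}) s :
  complete_triangulation T -> s \in T -> ord0 \notin val s ->
  exists i j k : vertex n,
    [/\ seated_clockwise i j k ord0, seg i k \in T, side T i j, side T j k
      & side T k ord0 /\ side T i ord0].
Proof.
move=> cT sT s0; have [pT _] := (completeP T).1 cT.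
have [dT _] := partialP _ pT.
pose P (ik : vertex n * vertex n) := (0 < ik.1 < ik.2)%N && (seg ik.1 ik.2 \in T).
have [i0 [k0 P0]] : exists i k, P (i, k).
  have [i [k [ik es]]] := segP s; exists i, k; rewrite /P /= -es sT ik !andbT.
  rewrite lt0n; apply: contra s0 => /eqP e.
  have -> : ord0 = i by apply: ord_inj.
  by rewrite es val_seg ?ltn_vertex_neq // !finset.inE eqxx.
pose f (ik : vertex n * vertex n) := (ik.2 - ik.1)%N.
case: (arg_maxnP f P0) => -[i k] /= /andP[/= /andP[ip ik] ikT] maxik.
have nik := ltn_vertex_neq ik.
have nki : k != i by rewrite eq_sym.
have sik : side T i k by rewrite /side ikT orbT.
have ski : side T k i by rewrite sideC.
have kiT : seg k i \in T by rewrite segC.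
have [j [b1 ij jk]] := triangle_ex cT sik (between_ordS nik (dT _ ikT)).
have [l [b2 kl li]] := triangle_ex cT ski (between_ordS nki (dT _ kiT)).
suff l0 : l = ord0.
  rewrite l0 in b2 kl li; exists i, j, k; split=> //.
    by rewrite clockwiseE b1 -(between_rot ord0 i k) -between_rot b2.
  by split=> //; rewrite sideC.
apply/eqP; rewrite ord_inE /=; apply/negPn/negP => l0.
case/or3P: b2 => h.
- by move: h ik; clear; lia.
- have Pl : P (l, k).
    rewrite /P /=; have -> : (0 < l < k)%N by move: l0 h; clear; lia.
    case/orP: kl; last by rewrite segC => ->.
    by rewrite segC is_edgeE; move: l0 h; clear; lia.
  by have := maxik _ Pl; move: h; rewrite /f /=; clear; lia.
- have Pl : P (i, l).
    rewrite /P /=; have -> : (0 < i < l)%N by move: ip h; clear; lia.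
    case/orP: li; last by rewrite segC => ->.
    by rewrite segC is_edgeE; move: ip h; clear; lia.
  by have := maxik _ Pl; move: h; rewrite /f /=; clear; lia.
Qed.

(** By induction on the number of chords of [T] that avoid vertex [0]: flipping
    the chord of [quad_ord0] replaces it with a chord through [0], whose value
    [v] is dictated by the exchange relation. *)
Lemma realize (R : realType) n (T : {set segment n}) (b : segment n -> R) :
  complete_triangulation T ->
  (forall s, 0 < b s) -> (forall s, is_edge s -> b s = 1) ->
  exists a : segment n -> R, positive_points a /\ forall s, s \in T -> a s = b s.
Proof.
have [k] := ubnP #|[set s in T | ord0 \notin val s]%SET|.
elim: k T b => // k IH T b; rewrite ltnS => Tk cT b0 be.
have [/exists_inP[s sT s0]|/exists_inPn all0] :=
  boolP [exists s in T, ord0 \notin val s]; last first.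
  have [a [ap aE]] := realize_fan b0 be.
  by exists a; split=> // s sT; apply: aE; apply/negPn/all0.
have [i [j [k' [cw ikT ij jk [kl il]]]]] := quad_ord0 cT sT s0.
set l : vertex n := ord0 in cw kl il.
have cT' := flip_complete cT cw ikT ij jk kl il; set T' := (_ |: _)%SET in cT'.
have [nij nik nil [njk njl nkl]] := clockwise_neq cw.
pose v := (b (seg i j) * b (seg k' l) + b (seg i l) * b (seg j k')) / b (seg i k').
pose b' s := if s == seg j l then v else b s.
have v0 : 0 < v by rewrite divr_gt0 // addr_gt0 // mulr_gt0.
have [pT _] := (completeP T).1 cT; have [_ crT] := partialP _ pT.
have [pT' _] := (completeP T').1 cT'; have [dT' _] := partialP _ pT'.
have djl : is_diagonal (seg j l) by apply: dT'; rewrite finset.in_setU1 eqxx.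
have cr : crossing (seg i k') (seg j l) by rewrite crossingE // cw.
have [|||a [ap aE]] := IH T' b' _ cT'.
- apply: leq_trans Tk; apply: proper_card; apply/properP; split.
    apply/fintype.subsetP => t /setIdP[].
    rewrite finset.in_setU1 => /orP[/eqP->|/setD1P[_ tT] t0].
      by rewrite val_seg // !finset.inE eqxx orbT.
    by apply/setIdP.
  have nI : ord0 \notin val (seg i k').
    by rewrite val_seg // !finset.inE negb_or !(eq_sym ord0) nil nkl.
  exists (seg i k'); first by apply/setIdP; split; [exact: ikT|exact: nI].
  rewrite finset.in_set nI andbT finset.in_setU1 setD11 orbF.
  by apply: contraTN cr => /eqP->; rewrite crossing_irr.
- by move=> t; rewrite /b'; case: ifP.
- move=> t et; rewrite /b' ifN ?be //.
  by apply: contraTneq et => ->; rewrite -/(is_diagonal _).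
have aT t : t \in T -> t != seg i k' -> a t = b t.
  move=> tT tik; rewrite aE.
    rewrite /b' ifN //; apply: contraTneq cr => <-.
    by apply: crT.
  by rewrite finset.in_setU1; apply/orP; right; apply/setD1P.
have ae t : is_edge t -> a t = 1 by case: ap => _ [+ _]; apply.
have aside x y : side T x y -> seg x y != seg i k' -> a (seg x y) = b (seg x y).
  by case/orP => [e _|]; [rewrite ae // be | exact: aT].
exists a; split=> // t tT; have [->|] := eqVneq t (seg i k'); last exact: aT.
have := plucker ap cw.
rewrite (aE (seg j l)); last by rewrite finset.in_setU1 eqxx.
rewrite /b' eqxx.
rewrite (aside i j) // ?seg_share_neq // (aside i l) //; last first.
  by apply: seg_share_neq => //; rewrite eq_sym.
rewrite (aside j k') //; last first.
  by rewrite segC (segC i); apply: seg_share_neq; rewrite 1?eq_sym.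
rewrite (aside k' l) //; last first.
  by rewrite (segC i); apply: seg_share_neq; rewrite 1?eq_sym // eq_sym.
rewrite -[RHS](@divfK _ (b (seg i k'))) ?gt_eqF // -/v [v * _]mulrC => E.
by apply: (mulIf _ E); rewrite gt_eqF.
Qed.

(** * Tropical values as growth rates *)

Lemma seq_argmax (R : realType) (X : eqType) (s : seq X) (f : X -> R) :
  s != [::] -> exists2 x, x \in s & forall y, y \in s -> f y <= f x.
Proof.
elim: s => // a [|b s] IH _.
  by exists a => [|y]; rewrite ?mem_head // mem_seq1 => /eqP->.
have [x xs xmax] := IH isT; have [ax|xa] := leP (f a) (f x).
  by exists x => [|y]; rewrite in_cons ?xs ?orbT // => /predU1P[->|/xmax].
exists a => [|y]; first exact: mem_head.
by rewrite in_cons => /predU1P[->//|/xmax/le_trans->//]; apply: ltW.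
Qed.

Definition weight (R : realType) n (T : {set segment n}) (x : segment n -> R)
    (m : exponent n) : R := \sum_(s in T) x s *~ m s.

Definition monomial (R : realType) n (T : {set segment n}) (a : segment n -> R)
    (m : exponent n) : R := \prod_(s in T) a s ^ m s.

Lemma expRz (R : realType) (x : R) (z : int) : expR (x *~ z) = expR x ^ z.
Proof.
case: z => k; first by rewrite -pmulrn -mulr_natl expRM_natl exprnP.
by rewrite NegzE mulrNz expRN -pmulrn -mulr_natl expRM_natl exprnN.
Qed.

(** In logarithmic coordinates a monomial becomes its weight, so that its growth
    is controlled by linear estimates. *)
Lemma monomial_expR (R : realType) n (T : {set segment n}) (a : segment n -> R) m :
  (forall s, 0 < a s) -> monomial T a m = expR (weight T (fun s => ln (a s)) m).
Proof.
move=> a0; rewrite /monomial /weight expR_sum.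
by apply: eq_bigr => s _; rewrite expRz lnK // posrE.
Qed.

Lemma weight_approx (R : realType) n (T : {set segment n}) (u v : segment n -> R)
    (g : R) (m : exponent n) :
  (forall s, s \in T -> `|u s - v s| <= g) ->
  `|weight T u m - weight T v m| <= \sum_(s in T) g *~ `|m s|.
Proof.
move=> uv; rewrite /weight -sumrB; apply: le_trans (ler_norm_sum _ _ _) _.
apply: ler_sum => s sT; rewrite -mulrzBl normrMz.
by rewrite -[leLHS]mulrzr -[leRHS]mulrzr ler_wpM2r ?ler0z ?uv.
Qed.

Lemma weightMn (R : realType) n (T : {set segment n}) (N : nat)
    (w : segment n -> R) (m : exponent n) :
  weight T (fun s => N%:R * w s) m = N%:R * weight T w m.
Proof. by rewrite /weight mulr_sumr; apply: eq_bigr => s _; rewrite mulrzAr. Qed.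

Lemma eval_pos_le (R : realType) n (T : {set segment n}) (P : laurent n)
    (a : segment n -> R) (m : exponent n) :
  (forall s, 0 < a s) -> m \in finsupp P -> monomial T a m <= laurent_eval T P a.
Proof.
move=> a0 mP; rewrite /laurent_eval (big_fsetD1 m) //=.
have mono0 m' : 0 < monomial T a m' by apply: prodr_gt0 => s _; rewrite exprz_gt0.
apply: ler_wpDr; first by apply: sumr_ge0 => m' _; apply: mulr_ge0 => //; apply/ltW/mono0.
rewrite -[leLHS]mul1r; apply: ler_wpM2r; first exact/ltW/mono0.
by rewrite ler1n lt0n -mem_finsupp.
Qed.

Lemma expR_bounded (R : realType) (d K : R) :
  (forall N : nat, expR (N%:R * d) <= K) -> d <= 0.
Proof.
move=> h; rewrite leNgt; apply/negP => d0.
have K0 : 0 <= K by apply: le_trans (h 0%N); rewrite ltW ?expR_gt0.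
have := archi_boundP (divr_ge0 K0 (ltW d0)); set N := Num.bound _ => lt.
have := le_trans (expR_ge1Dx _) (h N).
by move: lt; rewrite ltr_pdivrMr //; lra.
Qed.

(** Let [m] be a monomial of [F] in [T].  As all coefficients are positive
    integers, [F] is at least a constant times [exp (N weight m)] at the [N]-th
    point, and at most a constant times [exp (N weight m')], where [m'] has the
    largest weight in [T'].  So [weight m - weight m'] cannot be positive. *)
Lemma tropical_le (R : realType) n (T T' : coordinate_system n) (F : expansions n)
    (w : segment n -> R) (g : R) :
  Lplus R F ->
  (forall N : nat, exists a : segment n -> R, positive_points a /\
     forall s, (s \in val T) || (s \in val T') -> `|ln (a s) - N%:R * w s| <= g) ->
  forall m, m \in finsupp (F T) ->
  exists2 m', m' \in finsupp (F T') & weight (val T) w m <= weight (val T') w m'.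
Proof.
move=> [_ LF] app m mF.
pose D (S : {set segment n}) (m : exponent n) := \sum_(s in S) g *~ `|m s|.
have lo N a : positive_points a ->
    (forall s, (s \in val T) || (s \in val T') -> `|ln (a s) - N%:R * w s| <= g) ->
    expR (N%:R * weight (val T) w m) <=
    expR (D (val T) m) * laurent_eval (val T') (F T') a.
  move=> ap aw; have [a0 _] := ap.
  rewrite -(LF T) //.
  apply: le_trans (_ : expR (D (val T) m) * monomial (val T) a m <= _); last first.
    by rewrite ler_wpM2l ?expR_ge0 // eval_pos_le.
  rewrite monomial_expR // -expRD ler_expR -weightMn.
  have : `|weight (val T) (fun s => ln (a s)) m -
           weight (val T) (fun s => N%:R * w s) m| <= D (val T) m.
    by apply: weight_approx => s sT; rewrite aw ?sT.
  by rewrite ler_norml => /andP[h1 h2]; lra.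
have hi N a m' : positive_points a ->
    (forall s, (s \in val T) || (s \in val T') -> `|ln (a s) - N%:R * w s| <= g) ->
    monomial (val T') a m' <= expR (D (val T') m') * expR (N%:R * weight (val T') w m').
  move=> ap aw; have [a0 _] := ap.
  rewrite monomial_expR // -expRD ler_expR -weightMn.
  have : `|weight (val T') (fun s => ln (a s)) m' -
           weight (val T') (fun s => N%:R * w s) m'| <= D (val T') m'.
    by apply: weight_approx => s sT; rewrite aw ?sT ?orbT.
  by rewrite ler_norml => /andP[h1 h2]; lra.
(* An empty expansion in [T'] would make [F] vanish at a positive point. *)
have ne : (finsupp (F T') : seq _) != [::].
  apply/negP => /eqP e.
  have [a [ap aw]] := app 0%N; have := lo _ _ ap aw.
  rewrite /laurent_eval e big_nil mulr0 leNgt.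
  by rewrite expR_gt0.
have [m' m'F m'max] := seq_argmax (weight (val T') w) ne.
exists m' => //; rewrite -subr_le0.
pose K := expR (D (val T) m) *
  \sum_(k <- finsupp (F T')) (F T' k)%:R * expR (D (val T') k).
apply: (@expR_bounded _ _ K) => N.
have [a [ap aw]] := app N; have := lo _ _ ap aw.
rewrite mulrBr expRB ler_pdivrMr ?expR_gt0 // => h; apply: le_trans h _.
rewrite /K -mulrA ler_wpM2l ?expR_ge0 //.
rewrite /laurent_eval mulr_suml big_seq [leRHS]big_seq; apply: ler_sum => k kF.
rewrite -mulrA ler_wpM2l //; apply: le_trans (hi N _ _ ap aw) _.
by rewrite ler_wpM2l ?expR_ge0 // ler_expR ler_wpM2l // m'max.
Qed.

Lemma ln_add (R : realType) (u v : R) : 0 < u -> 0 < v ->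
  Num.max (ln u) (ln v) <= ln (u + v) <= Num.max (ln u) (ln v) + ln 2.
Proof.
move=> u0 v0; have uv0 : 0 < u + v by rewrite addr_gt0.
apply/andP; split.
  by rewrite ge_max !ler_ln ?posrE // lerDl lerDr !ltW.
have le2 t : u <= t -> v <= t -> 0 < t -> ln (u + v) <= ln t + ln 2.
  by move=> ut vt t0; rewrite -lnM ?posrE // ler_ln ?posrE ?mulr_gt0 //; lra.
have [uv|vu] := leP u v.
  by rewrite (le_trans (le2 v _ _ _)) // lerD2r le_max lexx orbT.
apply: le_trans (le2 u (lexx _) (ltW vu) u0) _.
by rewrite lerD2r le_max lexx.
Qed.

Lemma max_dist (R : realType) (u v u' v' g h : R) :
  `|u - u'| <= g -> `|v - v'| <= h ->
  `|Num.max u v - Num.max u' v'| <= Num.max g h.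
Proof.
rewrite !ler_norml => /andP[? ?] /andP[? ?].
have [p1 p2] : g <= Num.max g h /\ h <= Num.max g h.
  by rewrite !le_max !lexx orbT.
set M := Num.max g h in p1 p2 *; clearbody M.
by rewrite /Num.max; case: ltP => ?; case: ltP => ?; apply/andP; split; lra.
Qed.

(** A sum of two positive numbers lies between the larger one and its double. *)
Lemma ln_exchange (R : realType) n (a : segment n -> R) (i j k l : vertex n) :
  positive_points a -> seated_clockwise i j k l ->
  `|ln (a (seg i k)) + ln (a (seg j l)) -
    Num.max (ln (a (seg i j)) + ln (a (seg k l)))
            (ln (a (seg i l)) + ln (a (seg j k)))| <= ln 2.
Proof.
move=> ap cw; have [a0 _] := ap; have := plucker ap cw.
rewrite -!lnM ?posrE // => ->.
have /andP[] := ln_add (mulr_gt0 (a0 (seg i j)) (a0 (seg k l)))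
                       (mulr_gt0 (a0 (seg i l)) (a0 (seg j k))).
by rewrite ler_norml; lra.
Qed.

Lemma realize_exp (R : realType) n (T : {set segment n}) (N : nat)
    (z : segment n -> R) :
  complete_triangulation T -> (forall s, is_edge s -> z s = 0) ->
  exists a : segment n -> R, positive_points a /\
    forall s, (s \in T) || is_edge s -> ln (a s) = N%:R * z s.
Proof.
move=> cT ze; have [||a [ap aE]] := realize (b := fun s => expR (N%:R * z s)) cT.
- by move=> s; rewrite expR_gt0.
- by move=> s es; rewrite ze // mulr0 expR0.
exists a; split=> // s /orP[sT|es]; first by rewrite aE // expRK.
by case: ap => _ [+ _] => ->; rewrite // ze // mulr0 ln1.
Qed.

(** The error grows along [crossing_ind] by sums of earlier errors and [ln 2],
    so it does not depend on [N]. *)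
Lemma tropical_approx (R : realType) n (T : {set segment n}) (x : segment n -> R) :
  complete_triangulation T -> tropical_points Reals x ->
  exists g : R, forall N : nat, exists a : segment n -> R,
    positive_points a /\ forall s, `|ln (a s) - N%:R * x s| <= g.
Proof.
move=> cT tx; have [pT maxT] := (completeP T).1 cT; have [_ crT] := partialP _ pT.
have ex s := tropical_edge (s := s) tx.
have bound s : exists g : R, 0 <= g /\
    forall N (a : segment n -> R), positive_points a ->
    (forall t, (t \in T) || is_edge t -> ln (a t) = N%:R * x t) ->
    `|ln (a s) - N%:R * x s| <= g.
  move: s; apply: (crossing_ind crT) => [s ncs|a b c d cw cdT].
    exists 0; split=> // N a ap aT; rewrite aT ?subrr ?normr0 //.
    have [e|ne] := boolP (is_edge s); first by rewrite orbT.
    by rewrite maxT.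
  move=> [g1 [g10 h1]] [g2 [g20 h2]] [g3 [g30 h3]] [g4 [g40 h4]].
  exists (g1 + g2 + g3 + g4 + ln 2); split.
    by rewrite !addr_ge0 // ln_ge0 // ler1n.
  move=> N e ep eT.
  have := ln_exchange ep cw; have := tropical_max tx cw.
  move: (h1 _ _ ep eT) (h2 _ _ ep eT) (h3 _ _ ep eT) (h4 _ _ ep eT).
  move: (eT (seg c d)); rewrite cdT => /(_ isT) ->.
  move=> {}h1 {}h2 {}h3 {}h4 E1 E2.
  have {}E1 : N%:R * x (seg a b) = Num.max
     (N%:R * x (seg a c) + N%:R * x (seg b d))
     (N%:R * x (seg a d) + N%:R * x (seg c b)) - N%:R * x (seg c d).
    rewrite -!mulrDr -maxr_pMr // -E1; ring.
  have sum_dist (u v u' v' g h : R) : `|u - u'| <= g -> `|v - v'| <= h ->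
      `|u + v - (u' + v')| <= g + h.
    by move=> ug vh; rewrite opprD addrACA (le_trans (ler_normD _ _)) // lerD.
  have := max_dist (sum_dist _ _ _ _ _ _ h1 h3) (sum_dist _ _ _ _ _ _ h4 h2).
  have : Num.max (g1 + g3) (g4 + g2) <= g1 + g2 + g3 + g4.
    by rewrite ge_max; apply/andP; split; lra.
  by move: E2; rewrite E1 !ler_norml => /andP[? ?] ? /andP[? ?]; apply/andP; split; lra.
have [g gP] := choice bound.
exists (\sum_s g s) => N; have [a [ap aE]] := realize_exp N cT ex.
exists a; split=> // s; have [_ /(_ N a ap aE)/le_trans->//] := gP s.
by rewrite (bigD1 s) //= lerDl sumr_ge0 // => t _; have [] := gP t.
Qed.

Lemma tropical_indep (R : realType) n (T T' : coordinate_system n)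
    (F : expansions n) (x : segment n -> R) :
  Lplus R F -> tropical_points Reals x ->
  forall m, m \in finsupp (F T) ->
  exists2 m', m' \in finsupp (F T') & weight (val T) x m <= weight (val T') x m'.
Proof.
move=> LF tx; have [g gP] := tropical_approx (valP T) tx.
apply: (tropical_le LF (g := g)) => N.
by have [a [ap aE]] := gP N; exists a; split.
Qed.

Lemma weight_eq (R : realType) n (T : {set segment n}) (u v : segment n -> R) m :
  (forall s, s \in T -> u s = v s) -> weight T u m = weight T v m.
Proof. by move=> uv; apply: eq_bigr => s sT; rewrite uv. Qed.

(** Let [ik] be the diagonal [s] and [jl] its flip.  The vector [w] agrees with
    [z] on the new triangulation, and [w_ik] is determined by the exchange
    relation, so [w_ik < z_ik].  Since the exponent of [m] at [ik] is negative,
    [m] has a larger weight at [w] than at [z], and by [tropical_le] the new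
    expansion reaches this weight, at [w] and hence at [z]. *)
Lemma flip_gain (R : realType) n (T : coordinate_system n) (F : expansions n)
    (z : segment n -> R) (s : segment n) (m : exponent n) :
  Lplus R F -> (forall s, is_edge s -> z s = 0) ->
  (forall i j k l, seated_clockwise i j k l ->
     Num.max (z (seg i j) + z (seg k l)) (z (seg i l) + z (seg j k)) <
     z (seg i k) + z (seg j l)) ->
  s \in val T -> m \in finsupp (F T) -> m s < 0 ->
  exists (T' : coordinate_system n) (m' : exponent n),
    m' \in finsupp (F T') /\ weight (val T) z m < weight (val T') z m'.
Proof.
move=> LF ze zsup sT mF ms.
have [i [k [ik es]]] := segP s; have nik := ltn_vertex_neq ik.
rewrite {}es in sT ms; have cT := valP T.
have [j [l [cw ij jk kl il]]] := quad_ex cT nik sT.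
have cT' := flip_complete cT cw sT ij jk kl il; set S := (_ |: _)%SET in cT'.
pose T' : coordinate_system n := exist _ S cT'.
pose w s := if s == seg i k then
  Num.max (z (seg i j) + z (seg k l)) (z (seg i l) + z (seg j k)) - z (seg j l)
  else z s.
have [nij _ nil [njk njl nkl]] := clockwise_neq cw.
have neq a b : side (val T) a b -> seg a b != seg i k ->
    (seg a b \in S) || is_edge (seg a b).
  case/orP=> [-> _|abT ab]; first by rewrite orbT.
  by rewrite finset.in_setU1 finset.in_setD1 ab abT orbT.
have jlS : seg j l \in S by rewrite finset.in_setU1 eqxx.
have ikS : seg i k \notin S.
  rewrite finset.in_setU1 setD11 orbF; apply/seg_eqP => //.
  by case=> -[e _]; [rewrite e eqxx in nij|rewrite e eqxx in nil].
have wT' t : t \in S -> w t = z t.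
  by rewrite /w; case: eqP => // -> /(negP ikS).
have [|m' m'F] := tropical_le (T := T) (T' := T') (w := w) (g := ln 2) LF _ mF.
  move=> N; have [a [ap aE]] := realize_exp N cT' ze; exists a; split=> // t.
  have := ln_exchange ap cw.
  rewrite (aE (seg j l)) ?jlS // (aE (seg i j)); last first.
    by apply: neq => //; apply: seg_share_neq.
  rewrite (aE (seg i l)); last first.
    by apply: neq => //; apply: seg_share_neq; rewrite // eq_sym.
  rewrite (aE (seg j k)); last first.
    by apply: neq => //; rewrite segC (segC i); apply: seg_share_neq; rewrite 1?eq_sym.
  rewrite (aE (seg k l)); last first.
    apply: neq => //; rewrite (segC i).
    by apply: seg_share_neq; rewrite 1?eq_sym // eq_sym.
  rewrite -!mulrDr -maxr_pMr // => E.
  rewrite /w; case: eqP => [-> _|/eqP tik].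
    by rewrite mulrBr opprB addrA.
  case/orP=> [tT|tT']; rewrite aE ?subrr ?normr0 ?ln_ge0 ?ler1n //.
    by rewrite finset.in_setU1 finset.in_setD1 tik tT orbT.
  by rewrite tT'.
rewrite (weight_eq m' wT') => le.
exists T', m'; split=> //; apply: lt_le_trans le.
rewrite /weight (bigD1 (seg i k)) //= [ltRHS](bigD1 (seg i k)) //=.
rewrite (eq_bigr (fun t => w t *~ m t)); last first.
  by move=> t /andP[_ /negbTE tik]; rewrite /w tik.
rewrite ltrD2r -[ltLHS]mulrzr -[ltRHS]mulrzr ltr_nM2r ?ltrz0 //.
by rewrite /w eqxx ltrBlDr zsup.
Qed.

(** * Monomials with non-negative exponents *)

Lemma monomial_argmax (R : realType) n (F : expansions n)
    (f : coordinate_system n -> exponent n -> R) : nonzero F ->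
  exists (T : coordinate_system n) (m : exponent n), m \in finsupp (F T) /\
    forall T' m', m' \in finsupp (F T') -> f T' m' <= f T m.
Proof.
move=> [T0 [m0 /eqP]]; rewrite -mem_finsupp => m0F.
pose pairs := [seq (T, m) | T <- enum {: coordinate_system n},
                            m <- (finsupp (F T) : seq _)].
have mem T m : m \in finsupp (F T) -> (T, m) \in pairs.
  by move=> mF; apply/allpairsPdep; exists T, m; rewrite mem_enum.
have ne : pairs != [::].
  by apply/negP => /eqP e; have := mem _ _ m0F; rewrite e.
have [[T m] /allpairsPdep[T1 [m1 [_ mF [e1 e2]]]] mmax] :=
  seq_argmax (fun p : coordinate_system n * exponent n => f p.1 p.2) ne.
rewrite -{}e1 -{}e2 in mF; exists T, m; split=> // T' m' m'F.
exact: (mmax _ (mem _ _ m'F)).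
Qed.

(** The largest weight at [z] is attained, as there are finitely many monomials,
    and [flip_gain] excludes a negative exponent where it is attained. *)
Lemma nonneg_optimum (R : realType) n (F : expansions n) (z : segment n -> R) :
  Lplus R F -> nonzero F -> (forall s, is_edge s -> z s = 0) ->
  (forall i j k l, seated_clockwise i j k l ->
     Num.max (z (seg i j) + z (seg k l)) (z (seg i l) + z (seg j k)) <
     z (seg i k) + z (seg j l)) ->
  exists (T : coordinate_system n) (m : exponent n),
    [/\ m \in finsupp (F T), forall s, s \in val T -> 0 <= m s &
     forall T' m', m' \in finsupp (F T') -> weight (val T') z m' <= weight (val T) z m].
Proof.
move=> LF nzF ze zsup.
have [T [m [mF mmax]]] := monomial_argmax (fun T m => weight (val T) z m) nzF.
exists T, m; split=> // s sT.
rewrite leNgt; apply/negP => ms.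
have [T' [m' [m'F]]] := flip_gain LF ze zsup sT mF ms.
by rewrite ltNge mmax.
Qed.

(** A segment that cuts off [d] sides of the [N]-gon, [N = n + 3], has value
    [d (N - d) - (N - 1)], which is [0] on the edges.  For a quadrilateral that
    cuts the boundary into arcs of [p1], [p2], [p3] and [p4] sides, the two
    exchange inequalities hold with the gaps [2 p2 p4] and [2 p1 p3]. *)
Lemma strict_potential (R : realType) n : exists c : segment n -> R,
  (forall s, is_edge s -> c s = 0) /\
  (forall i j k l, seated_clockwise i j k l ->
     Num.max (c (seg i j) + c (seg k l)) (c (seg i l) + c (seg j k)) <
     c (seg i k) + c (seg j l)).
Proof.
pose N : R := n.+3%:R.
have [c cE] := chord_fun (fun i j : vertex n =>
  (j%:R - i%:R) * (N - (j%:R - i%:R)) - (N - 1) : R).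
exists c; split=> [s|].
  have [i [j [ij ->]]] := segP s; rewrite is_edgeE // cE // /N.
  case/orP => [/eqP->|/andP[/eqP-> /eqP->]]; rewrite ?subr0.
    by rewrite -[i.+1%:R]natr1; ring.
  by rewrite -[n.+3%:R]natr1; ring.
apply: clockwise_incr => [i j k l|i j k l ij jk kl].
  by rewrite maxC (segC k i) (segC l i) (segC j i) [in ltRHS]addrC
    [c (seg j k) + _]addrC.
have ik := ltn_trans ij jk; have jl := ltn_trans jk kl; have il := ltn_trans ij jl.
rewrite gt_max !cE //.
have : 0 < (j%:R - i%:R : R) by rewrite subr_gt0 ltr_nat.
have : 0 < (k%:R - j%:R : R) by rewrite subr_gt0 ltr_nat.
have : 0 < (l%:R - k%:R : R) by rewrite subr_gt0 ltr_nat.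
have : 0 < N - (l%:R - i%:R : R).
  by have := ltn_ord l; rewrite -(ltr_nat R) -/N; have := ler0n R i; lra.
move=> p4 p3 p2 p1; have := mulr_gt0 p2 p4; have := mulr_gt0 p1 p3.
by move=> *; apply/andP; split; nra.
Qed.

Lemma weightD (R : realType) n (T : {set segment n}) (x c : segment n -> R) (e : R) m :
  weight T (fun s => x s + e * c s) m = weight T x m + e * weight T c m.
Proof.
rewrite /weight mulr_sumr -big_split /=; apply: eq_bigr => s _.
by rewrite mulrzDl mulrzAr.
Qed.

Lemma weight_sum (R : realType) n (T : {set segment n}) p
    (l : 'I_p -> segment n -> R) m :
  weight T (fun s => \sum_k l k s) m = \sum_k weight T (l k) m.
Proof.
by rewrite /weight exchange_big /=; apply: eq_bigr => s _; rewrite mulrz_suml.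
Qed.

Lemma le_eps (R : realType) (u v K : R) :
  (forall e, 0 < e -> u <= v + e * K) -> u <= v.
Proof.
move=> h; apply/ler_addgt0Pr => e e0.
have K1 : 0 < `|K| + 1 by rewrite ltr_wpDl.
apply: le_trans (h (e / (`|K| + 1)) _) _; first by rewrite divr_gt0.
rewrite lerD2l -mulrA ger_pMr // mulrC ler_pdivrMr // mul1r.
by rewrite (le_trans (ler_norm K)) // lerDl.
Qed.

(** Apply [nonneg_optimum] to [z = x + e c], with [c] a strict potential.  The
    monomial [m'] it provides has non-negative exponents, so that
    [weight x m' <= \sum_k weight (l k) m' <= \sum_k r k].  By its optimality
    its weight at [z] is at least that of [m].  The two differences between
    [z] and [x] are [e] times weights of [c], bounded over all monomials, and
    disappear as [e] goes to [0]. *)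
Lemma tropical_sum_le (R : realType) n p (F : expansions n)
    (x : segment n -> R) (l : 'I_p -> segment n -> R) (r : 'I_p -> R)
    (T : coordinate_system n) :
  Lplus R F -> nonzero F -> tropical_points Reals x ->
  (forall k, tropical_points Reals (l k)) ->
  (forall s, x s <= \sum_k l k s) ->
  (forall k m, m \in finsupp (F T) -> weight (val T) (l k) m <= r k) ->
  forall m, m \in finsupp (F T) -> weight (val T) x m <= \sum_k r k.
Proof.
move=> LF nzF tx tl xl lr m mF.
have [c [ce csup]] := strict_potential R n.
have [Tc [mc [_ cmax]]] := monomial_argmax (fun T m => weight (val T) c m) nzF.
have xe s := tropical_edge (s := s) tx.
apply: (@le_eps _ _ _ (weight (val Tc) c mc - weight (val T) c m)) => e e0.
pose z s := x s + e * c s.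
have [||T' [m' [m'F m'0 m'max]]] := nonneg_optimum (z := z) LF nzF.
- by move=> s es; rewrite /z xe // ce // mulr0 addr0.
- move=> i j k k' cw; have E1 := tropical_max tx cw; have := csup _ _ _ _ cw.
  rewrite -(ltr_pM2l e0) maxr_pMr ?ltW // !mulrDr gt_max => /andP[].
  rewrite /z gt_max; have : x (seg i j) + x (seg k k') <= x (seg i k) + x (seg j k').
    by rewrite E1 le_max lexx.
  have : x (seg i k') + x (seg j k) <= x (seg i k) + x (seg j k').
    by rewrite E1 le_max lexx orbT.
  by move=> *; apply/andP; split; lra.
have := m'max _ _ mF; rewrite !weightD => le1.
have le2 : e * weight (val T') c m' <= e * weight (val Tc) c mc.
  by apply: ler_wpM2l; [exact: ltW|exact: cmax].
suff : weight (val T') x m' <= \sum_k r k by rewrite mulrBr; lra.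
apply: le_trans (_ : weight (val T') (fun s => \sum_k l k s) m' <= _).
  apply: ler_sum => s sT; rewrite -[leLHS]mulrzr -[leRHS]mulrzr.
  by rewrite ler_wpM2r ?ler0z ?m'0.
rewrite weight_sum; apply: ler_sum => k _.
have [m2 m2F le3] := tropical_indep T LF (tl k) m'F.
exact: le_trans le3 (lr _ _ m2F).
Qed.

(** * The coordinate functions are indecomposable *)

(** Sums and products of Laurent polynomials with coefficients in [nat] are
    simplest on the lists of their monomials, with repetitions. *)
Definition laurent_of n (ms : seq (exponent n)) : laurent n :=
  [fsfun m in [fset m in ms]%fset => count_mem m ms].

Lemma laurent_ofE n (ms : seq (exponent n)) m : laurent_of ms m = count_mem m ms.
Proof.
by rewrite fsfunE in_fset /=; case: ifPn => // /count_memPn.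
Qed.

Lemma mem_laurent_of n (ms : seq (exponent n)) m :
  (m \in finsupp (laurent_of ms)) = (m \in ms).
Proof. by rewrite mem_finsupp laurent_ofE -lt0n -has_count has_pred1. Qed.

Lemma laurent_of_eval (R : realType) n (T : {set segment n}) (ms : seq (exponent n))
    (a : segment n -> R) :
  laurent_eval T (laurent_of ms) a = \sum_(m <- ms) monomial T a m.
Proof.
rewrite -big_undup_iterop_count /laurent_eval.
rewrite (perm_big (undup ms)); last first.
  apply: uniq_perm; rewrite ?fset_uniq ?undup_uniq // => m.
  by rewrite mem_undup mem_laurent_of.
by apply: eq_bigr => m _; rewrite laurent_ofE mulr_natl.
Qed.

Definition unit_exponent n (s : segment n) : exponent n :=
  [ffun t => if t == s then 1 else 0].

Lemma monomial_unit (R : realType) n (T : {set segment n}) (a : segment n -> R) s :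
  s \in T -> monomial T a (unit_exponent s) = a s.
Proof.
move=> sT; rewrite /monomial (bigD1 s) //= big1 => [|t /andP[_ /negbTE ts]].
  by rewrite ffunE eqxx expr1z mulr1.
by rewrite ffunE ts expr0z.
Qed.

Lemma weight_unit (R : realType) n (T : {set segment n}) (x : segment n -> R) s :
  s \in T -> weight T x (unit_exponent s) = x s.
Proof.
move=> sT; rewrite /weight (bigD1 s) //= big1 => [|t /andP[_ /negbTE ts]].
  by rewrite ffunE eqxx addr0.
by rewrite ffunE ts.
Qed.

Definition exponent_exchange n (u : segment n) (m1 m2 : exponent n) : exponent n :=
  [ffun t => m1 t + m2 t - unit_exponent u t].

Lemma monomial_exchange (R : realType) n (T : {set segment n}) (a : segment n -> R)
    u m1 m2 :
  (forall s, 0 < a s) -> u \in T ->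
  monomial T a (exponent_exchange u m1 m2) = monomial T a m1 * monomial T a m2 / a u.
Proof.
move=> a0 uT; rewrite -(monomial_unit a uT) /monomial.
have nz s : a s \is a GRing.unit by rewrite unitfE gt_eqF.
rewrite -prodfV -!big_split /=; apply: eq_bigr => t _.
by rewrite ffunE !expfzDr ?gt_eqF // invr_expz.
Qed.

(** In the exchange relation for [ab] and a chord [cd] of [T], solving for [A_ab]
    divides by the single variable [A_cd], and involves no subtraction. *)
Lemma laurent_positive (R : realType) n (T : {set segment n}) (s : segment n) :
  complete_triangulation T ->
  exists ms : seq (exponent n),
    (forall m, m \in ms -> forall t, t \notin T -> m t = 0) /\
    (forall a : segment n -> R, positive_points a ->
       \sum_(m <- ms) monomial T a m = a s).
Proof.
move=> cT; have [pT maxT] := (completeP T).1 cT; have [_ crT] := partialP _ pT.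
have unit0 u t : u \in T -> t \notin T -> unit_exponent u t = 0.
  by move=> uT tT; rewrite ffunE ifN //; apply: contraNneq tT => ->.
move: s; apply: (crossing_ind crT) => [s ncs|a b c d cw cdT].
  have [es|ds] := boolP (is_edge s).
    exists [:: [ffun=> 0]]; split=> [m|a ap].
      by rewrite mem_seq1 => /eqP-> t _; rewrite ffunE.
    have [_ [-> //]] := ap; rewrite big_seq1 /monomial big1 // => t _.
    by rewrite ffunE expr0z.
  have sT : s \in T by apply: maxT.
  exists [:: unit_exponent s]; split=> [m|a _].
    by rewrite mem_seq1 => /eqP-> t; apply: unit0.
  by rewrite big_seq1 monomial_unit.
move=> [m1 [z1 e1]] [m2 [z2 e2]] [m3 [z3 e3]] [m4 [z4 e4]].
exists ([seq exponent_exchange (seg c d) m m' | m <- m1, m' <- m3] ++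
        [seq exponent_exchange (seg c d) m m' | m <- m4, m' <- m2]).
split=> [m|f fp].
  rewrite mem_cat => /orP[] /allpairsP[[k k'] /= [h h' ->]] t tT;
    rewrite ffunE unit0 // subr0.
    by rewrite (z1 _ h) // (z3 _ h') // addr0.
  by rewrite (z4 _ h) // (z2 _ h') // addr0.
have [f0 _] := fp.
have part l1 l2 : \sum_(m <- [seq exponent_exchange (seg c d) m m' | m <- l1, m' <- l2])
    monomial T f m =
    (\sum_(m <- l1) monomial T f m) * (\sum_(m <- l2) monomial T f m) / f (seg c d).
  rewrite big_allpairs_dep big_distrlr /= mulr_suml; apply: eq_bigr => m _.
  by rewrite mulr_suml; apply: eq_bigr => m' _; rewrite monomial_exchange.
rewrite big_cat /= !part e1 // e2 // e3 // e4 // -mulrDl -(plucker fp cw) mulfK //.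
by rewrite gt_eqF.
Qed.

Lemma complete_ex n (s : segment n) : is_diagonal s ->
  exists T : coordinate_system n, s \in val T.
Proof.
move=> ds; have pT : partial_triangulation [set s]%SET.
  apply/partialP; split=> [t|t u]; rewrite !finset.in_set1 => /eqP-> //.
  by move=> /eqP->; rewrite crossing_irr.
have [T maxT sT] := maxset_exists pT.
by exists (exist _ T maxT); apply: (fintype.subsetP sT); rewrite finset.in_set1.
Qed.

Lemma positive_point_ex (R : realType) n (T : coordinate_system n) :
  exists a : segment n -> R, positive_points a.
Proof.
by have [//|//|a [ap _]] := realize (b := fun=> 1 : R) (valP T); exists a.
Qed.

(** In a coordinate system that contains [s] the expansion is one monomial with
    coefficient [1].  A nonzero element of [L_+] is positive at positive points,
    so both summands of a decomposition would have a nonzero expansion there,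
    while their coefficients add up to at most one monomial. *)
Lemma variable_ex (R : realType) n (s : segment n) : is_diagonal s ->
  exists F : expansions n, indecomposable R F /\
    forall T : coordinate_system n, s \in val T -> F T = laurent_of [:: unit_exponent s].
Proof.
move=> ds.
have /choice[f fP] (T : coordinate_system n) := laurent_positive R s (valP T).
pose F (T : coordinate_system n) :=
  laurent_of (if s \in val T then [:: unit_exponent s] else f T).
have FT (T : coordinate_system n) : s \in val T -> F T = laurent_of [:: unit_exponent s].
  by rewrite /F => ->.
have evF (T : coordinate_system n) (a : segment n -> R) :
    positive_points a -> laurent_eval (val T) (F T) a = a s.
  move=> ap; rewrite laurent_of_eval; case: ifPn => [sT|_].
    by rewrite big_seq1 monomial_unit.
  by have [_ ->] := fP T.
have LF : Lplus R F.
  split=> [T m|T T' a ap]; last by rewrite !evF.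
  rewrite mem_laurent_of; case: ifPn => [sT|_].
    rewrite mem_seq1 => /eqP-> t tT; rewrite ffunE ifN //.
    by apply: contraNneq tT => ->.
  by have [h _] := fP T; apply: h.
have [T sT] := complete_ex ds.
have [a ap] := positive_point_ex R T; have [a0 _] := ap.
exists F; split=> //; split=> //; split.
  exists T, (unit_exponent s); rewrite FT // laurent_ofE /= eqxx; done.
case=> G [H [LG nG LH nH sum]].
have zero K : Lplus R K -> nonzero K -> K T (unit_exponent s) <> 0%N \/
    exists2 m, m <> unit_exponent s & K T m <> 0%N.
  move=> LK [T' [m' /eqP]]; rewrite -mem_finsupp => m'K.
  have pos : 0 < laurent_eval (val T) (K T) a.
    have [_ /(_ T T' a ap)->] := LK.
    apply: lt_le_trans (eval_pos_le (val T') a0 m'K).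
    by rewrite monomial_expR // expR_gt0.
  have : (finsupp (K T) : seq _) != [::].
    by apply/negP => /eqP e; move: pos; rewrite /laurent_eval e big_nil ltxx.
  case E : (finsupp (K T) : seq _) => [//|m ms] _.
  have /eqP mK : K T m != 0%N.
    by rewrite -mem_finsupp -[_ \in _]/(m \in (finsupp (K T) : seq _)) E mem_head.
  have [<-|/eqP ne] := eqVneq m (unit_exponent s); first by left.
  by right; exists m.
have sumE m : (G T m + H T m)%N = (unit_exponent s == m).
  by rewrite -sum FT // laurent_ofE /= addn0.
have off m : m <> unit_exponent s -> G T m = 0%N /\ H T m = 0%N.
  move=> /eqP ne; have := sumE m; rewrite [_ == m]eq_sym (negbTE ne) => /eqP.
  by rewrite addn_eq0 => /andP[/eqP-> /eqP->].
have := sumE (unit_exponent s); rewrite eqxx.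
case: (zero G LG nG) => [|[m /off[]]] //; case: (zero H LH nH) => [|[m /off[]]] //.
by case: (G T _) => // p; case: (H T _) => // q _ _; rewrite addSn addnS.
Qed.

(** * Single points and Minkowski sums *)

Lemma tropical_fin (R : realType) n (T : coordinate_system n) (F : expansions n)
    (x : segment n -> R) : (finsupp (F T) : seq _) != [::] ->
  exists r : R, tropical T F x = r%:E /\
    (exists2 m, m \in finsupp (F T) & weight (val T) x m = r) /\
    forall m, m \in finsupp (F T) -> weight (val T) x m <= r.
Proof.
move=> ne; have [m mF mmax] := seq_argmax (weight (val T) x) ne.
exists (weight (val T) x m); split; last by split=> //; exists m.
apply/le_anti/andP; split.
  rewrite /tropical big_seq; apply: bigmax_le => [|k kF]; first exact: leNye.
  by rewrite lee_fin; apply: mmax.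
exact: (le_bigmax_seq -oo%E m xpredT (fun k => (weight (val T) x k)%:E) mF).
Qed.

Lemma finsupp_nonempty (R : realType) n (T : coordinate_system n) (F : expansions n)
    (x : segment n -> R) :
  Lplus R F -> nonzero F -> tropical_points Reals x ->
  (finsupp (F T) : seq _) != [::].
Proof.
move=> LF [T0 [m0 /eqP]]; rewrite -mem_finsupp => m0F tx.
have [m mF _] := tropical_indep T LF tx m0F.
by apply/negP => /eqP e; move: mF; rewrite -[_ \in _]/(m \in (finsupp (F T) : seq _)) e.
Qed.

(** The value does not depend on the coordinate system, by [tropical_indep], and
    it is plain in one that contains [s]. *)
Lemma tropical_variable (R : realType) n (s : segment n) (F : expansions n)
    (T : coordinate_system n) (x : segment n -> R) :
  is_diagonal s -> indecomposable R F ->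
  (forall T : coordinate_system n, s \in val T ->
     F T = laurent_of [:: unit_exponent s]) ->
  tropical_points Reals x -> tropical T F x = (x s)%:E.
Proof.
move=> ds [LF [nzF _]] FE tx; have [T' sT'] := complete_ex ds.
have [r [-> [[m mF <-] mmax]]] := tropical_fin x (finsupp_nonempty T LF nzF tx).
congr (_%:E); apply/le_anti/andP; split.
  have [m' + le] := tropical_indep T' LF tx mF.
  rewrite FE // mem_laurent_of mem_seq1 => /eqP e.
  by rewrite e weight_unit // in le.
have uF : unit_exponent s \in finsupp (F T').
  by rewrite FE // mem_laurent_of mem_head.
have [m' m'F] := tropical_indep T LF tx uF.
by rewrite weight_unit // => /le_trans-> //; apply: mmax.
Qed.

Theorem theorem1p10 (R : realType) (n : nat) (hn : (1 <= n)%N)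
    (A : number_system) (T : coordinate_system n) :
  (forall l : segment n -> R, tropical_points A l -> convex A T [set l]) /\
  (forall (m : nat) (l : 'I_m -> segment n -> R),
     (forall k : 'I_m, tropical_points A (l k)) ->
     forall c : segment n -> R,
     (forall s : segment n, is_diagonal s -> c s = \sum_(k < m) l k s) ->
     stasheff c /\
     minkowski_sum A T l = tropical_points A `&` face c finset.set0).
Proof.
split=> [l tl|p l tl c cE].
  have tlR := tropical_points_real tl.
  apply/seteqP; split=> [x ->|x [tx xl]].
    by split=> // F _; rewrite /support_bound image_set1 ereal_sup1.
  have txR := tropical_points_real tx.
  apply: tropical_rigid => // s; have [es|ds] := boolP (is_edge s).
    by rewrite (tropical_edge tx es) (tropical_edge tl es).
  have [F [indF FE]] := variable_ex R ds.
  have := xl F indF; rewrite /support_bound image_set1 ereal_sup1.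
  by rewrite !(tropical_variable T ds indF FE) // lee_fin.
have tlR k := tropical_points_real (tl k).
pose y s := \sum_k l k s.
have ye s : is_edge s -> y s = 0.
  by move=> es; rewrite /y big1 // => k _; rewrite (tropical_edge (tl k)).
split.
  apply: (stasheff_super cE ye) => i j k k' cw.
  rewrite /y ge_max -!big_split; apply/andP; split; apply: ler_sum => q _;
    by rewrite /= (tropical_max (tlR q) cw) le_max lexx ?orbT.
apply/seteqP; split=> x [tx].
  have txR := tropical_points_real tx.
  move=> xl; split=> //; split=> //; split=> s; first by rewrite finset.in_set0.
  rewrite finset.in_set => /and3P[ds _ _].
  have [F [indF FE]] := variable_ex R ds.
  have := xl F indF; rewrite (tropical_variable T ds indF FE) //.
  under eq_bigr do rewrite (tropical_variable T ds indF FE) //.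
  by rewrite sumEFin lee_fin cE.
move=> [txR [_ xc]]; split=> // F [LF [nzF _]].
have ne := finsupp_nonempty T LF nzF txR.
have /choice[r rP] k := tropical_fin (l k) ne.
under eq_bigr do rewrite (rP _).1.
have [u [-> [[m mF <-] _]]] := tropical_fin x ne.
rewrite sumEFin lee_fin.
apply: (tropical_sum_le LF nzF txR tlR) mF => [s|k m']; last by have [_ [_]] := rP k; apply.
have [es|ds] := boolP (is_edge s); first by rewrite (tropical_edge txR) // -/(y s) ye.
rewrite -cE //; apply: xc; rewrite finset.in_set /is_diagonal ds finset.in_set0 /=.
by apply/forall_inP => t; rewrite finset.in_set0.
Qed.
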